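(* Let $d\ge2$ and $\alpha>0$. Let $u\in\mathscr{D}'(\mathbb{T}^d)$ be a singular solution to the stationary fractional Navier-Stokes equations $$\mathrm{div}(u\otimes u)+(-\Delta)^\alpha u+\nabla p=0,\qquad \mathrm{div}\,u=0,\qquad \hat u(0)=0 \quad\text{on }\mathbb{T}^d.$$ Then $U:=\mathbf{1}_{(0,\infty)}(t)\otimes u(x)$ in $\mathscr{D}'((0,\infty)\times\mathbb{T}^d)$ (i.e. $U(t)=u$ for all $t>0$) is a mild solution to the fractional Navier-Stokes equations $$\partial_tU+\mathrm{div}(U\otimes U)+(-\Delta)^\alpha U+\nabla p=0,\qquad \mathrm{div}\,U=0$$ on $[0,\infty)\times\mathbb{T}^d$ with initial data $U(0)=u$.
   Context: $\mathbb{T}^d=\mathbb{R}^d/\mathbb{Z}^d$; $\hat f(m)=\langle f,e^{-2\pi i m\cdot x}\rangle$ for $f\in\mathscr{D}'(\mathbb{T}^d)$; $(-\Delta)^\alpha f=\sum_{m}(2\pi|m|)^{2\alpha}\hat f(m)e^{2\pi i m\cdot x}$. For vectors, $(a\otimes b)_{ij}=a_ib_j$; for matrix fields, $(\mathrm{div} A)_i=\partial_jA_{ij}$. Dyadic integers are integer powers of $2$ that are $\ge 1$. Fix a radial bump function $\chi\in C_c^\infty(\mathbb{R}^d)$ supported in $B(0,1)$ and equal to $1$ on $B(0,9/10)$. For dyadic $N$, $P_{\le N}f=\sum_{m}\chi(m/N)\hat f(m)e^{2\pi i m\cdot x}$, $P_1=P_{\le 1}$, $P_N=P_{\le N}-P_{\le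 N/2}$ for $N\ge2$. $\dot H^{s}$ is the space of distributions modulo constants with $\|f\|_{\dot H^s}=(\sum_{m\neq0}|m|^{2s}|\hat f(m)|^2)^{1/2}<\infty$. For $u\in\mathscr{D}'(\mathbb{T}^d)$ vector-valued and $s>0$, $u\otimes u$ is well-defined as a paraproduct in $\dot H^{-s}$ if $\sum_{N,M}\|P_Nu\otimes P_Mu\|_{\dot H^{-s}}<\infty$ ($N,M$ over all dyadic integers); then $u\otimes u:=\sum_{N,M}P_Nu\otimes P_Mu$ in $\dot H^{-s}$ (defined modulo constants, identified with its mean-zero representative). For time-dependent $U$, $(U\otimes U)(s)$ is the paraproduct of $U(s)$ with itself. Singular solution (stationary): $u\in\mathscr{D}'(\mathbb{T}^d)$ with $\hat u(0)=0$, weakly divergence free, such that there exists $s>0$ for which $u\otimes u$ is well-defined as a paraproduct in $\dot H^{-s}$, and $-\langle u\otimes u,\nabla\varphi\rangle+\langle u,(-\Delta)^\alpha\varphi\rangle=0$ for every divergence-free $\varphi\in C^\infty(\mathbb{T}^d)$. Mild solution: for divergence-free $u_{\mathrm{in}}\in\mathscr{D}'(\mathbb{T}^d)$, $U$ is a mild solution on $[0,T)$ ($0<T\le\infty$) with initial data $u_{\mathrm{in}}$ if $U(t)=e^{-t(-\Delta)^\alpha}u_{\mathrm{in}}-B_\alpha(U,U)(t)$ in $\mathscr{D}'((0,T)\times\mathbb{T}^d)$, where $B_\alpha(U,U)(t)=\int_0^te^{-(t-s)(-\Delta)^\alpha}\mathbb{P}\,\mathrm{div}(U\otimes U)(s)\,ds$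 and $\mathbb{P}$ is the Leray projection onto divergence-free vector fields. *)

(* Defs.v *)
From HB Require Import structures.
From mathcomp Require Import all_boot all_order all_algebra.
From mathcomp Require Import complex.
From mathcomp Require Import all_classical all_reals all_analysis.

Set Implicit Arguments.
Unset Strict Implicit.
Unset Printing Implicit Defensive.
Import Order.TTheory GRing.Theory Num.Theory.
Import numFieldNormedType.Exports.

Local Open Scope classical_set_scope.
Local Open Scope ring_scope.
Local Open Scope complex_scope.

(* Conventions. A function on the torus T^d = R^d/Z^d is a Z^d-periodic
   function 'rV[R]_d -> R[i].  A distribution is a functional on all functions
   'rV[R]_d -> R[i], of which only the values on smooth periodic functions
   matter; the pairing <T, phi> is bilinear (no conjugation).  R[i] carries no
   canonical topology in the library, so derivatives, limits and integrals of
   complex-valued functions are taken on real and imaginary parts. *)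

Section Smooth.
Context {R : realType}.
Local Notation C := R[i].

Definition Rpartial n (i : 'I_n) (f : 'rV[R]_n -> R) : 'rV[R]_n -> R :=
  fun x => 'D_(delta_mx 0 i) f x.

Definition Rpartials n (l : seq 'I_n) (f : 'rV[R]_n -> R) : 'rV[R]_n -> R :=
  foldr (@Rpartial n) f l.

Definition Rsmooth n (f : 'rV[R]_n -> R) : Prop :=
  forall l : seq 'I_n,
    continuous (Rpartials l f) /\
    forall (i : 'I_n) (x : 'rV[R]_n), derivable (Rpartials l f) x (delta_mx 0 i).

Definition partials n (l : seq 'I_n) (f : 'rV[R]_n -> C) : 'rV[R]_n -> C :=
  fun x => Rpartials l (fun y => complex.Re (f y)) x
    +i* Rpartials l (fun y => complex.Im (f y)) x.

Definition partial n (i : 'I_n) (f : 'rV[R]_n -> C) : 'rV[R]_n -> C :=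
  partials [:: i] f.

Definition smooth n (f : 'rV[R]_n -> C) : Prop :=
  Rsmooth (fun x => complex.Re (f x)) /\ Rsmooth (fun x => complex.Im (f x)).

Definition enorm n (x : 'rV[R]_n) : R := Num.sqrt (\sum_i x 0 i ^+ 2).

Definition bump_function d (chi : 'rV[R]_d -> R) : Prop :=
  [/\ Rsmooth chi,
      forall x y, enorm x = enorm y -> chi x = chi y,
      closure [set x | chi x != 0] `<=` [set x | enorm x < 1] &
      forall x, enorm x < 9 / 10 -> chi x = 1].

Definition ivec d (m : 'rV[int]_d) : 'rV[R]_d := map_mx intr m.

Definition periodic d (f : 'rV[R]_d -> C) : Prop :=
  forall (m : 'rV[int]_d) x, f (x + ivec m) = f x.

Definition test d (phi : 'rV[R]_d -> C) : Prop := smooth phi /\ periodic phi.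

End Smooth.

Section Integrals.
Context {R : realType}.
Local Notation C := R[i].
Local Notation mu := (@lebesgue_measure R).

Definition cintegrable (D : set R) (f : R -> C) : Prop :=
  mu.-integrable D (fun t => (complex.Re (f t))%:E) /\
  mu.-integrable D (fun t => (complex.Im (f t))%:E).

Definition cintegral (D : set R) (f : R -> C) : C :=
  (\int[mu]_(t in D) complex.Re (f t)) +i* (\int[mu]_(t in D) complex.Im (f t)).

(* Integral over the unit cube [0,1]^n, a fundamental domain of T^n, as an
   iterated integral; it is only used for continuous integrands. *)
Fixpoint cube_integral n : ('rV[R]_n -> C) -> C :=
  match n with
  | 0 => fun f => f 0
  | n'.+1 => fun f => cintegral `[0, 1]
      (fun t => cube_integral (fun y : 'rV[R]_n' => f (row_mx t%:M y)))
  end.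

End Integrals.

Section Fourier.
Context {R : realType} {d : nat}.
Local Notation C := R[i].
Local Notation functional := (('rV[R]_d -> C) -> C).

Definition clim (u : nat -> C) : C :=
  lim ((fun n => complex.Re (u n)) @ \oo)
  +i* lim ((fun n => complex.Im (u n)) @ \oo).

(* Sum over Z^d, as the limit of the sums over the boxes {-n,..,n}^d.  Every
   series below is absolutely convergent or has finitely many nonzero terms. *)
Definition zsum (c : 'rV[int]_d -> C) : C :=
  clim (fun n => \sum_(k : {ffun 'I_d -> 'I_(n.*2.+1)})
                   c (\row_i ((k i)%:Z - n%:Z))).

(* e^{2 pi i m.x} *)
Definition ex (m : 'rV[int]_d) (x : 'rV[R]_d) : C :=
  let theta := 2 * pi * \sum_i (m 0 i)%:~R * x 0 i in
  cos theta +i* sin theta.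

Definition znorm (m : 'rV[int]_d) : R := enorm (ivec m).

Definition fourier (f : 'rV[R]_d -> C) (m : 'rV[int]_d) : C :=
  cube_integral (fun x => f x * ex (- m) x).

Definition fcoef (T : functional) (m : 'rV[int]_d) : C := T (ex (- m)).

(* The series sum_m c_m e^{2 pi i m.x} in D'(T^d): the pairing of phi with
   e^{2 pi i m.x} is the Fourier coefficient of phi at -m. *)
Definition fseries (c : 'rV[int]_d -> C) : functional :=
  fun phi => zsum (fun m => c m * fourier phi (- m)).

(* Continuity for the Frechet topology of C^oo(T^d). *)
Definition distribution (T : functional) : Prop :=
  [/\ forall (a : C) phi psi, test phi -> test psi ->
        T (fun x => a * phi x + psi x) = a * T phi + T psi &
      exists (K : R) (k : nat), forall phi (B : R), test phi ->
        (forall l : seq 'I_d, (size l <= k)%N ->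
           forall x, `|partials l phi x| <= B%:C) ->
        `|T phi| <= (K * B)%:C].

Definition divergence_free (u : 'I_d -> functional) : Prop :=
  forall psi, test psi -> \sum_i u i (partial i psi) = 0.

(* symbol (2 pi |m|)^{2 alpha}; it vanishes at m = 0 when alpha > 0 *)
Definition fl_symbol (alpha : R) (m : 'rV[int]_d) : R :=
  (2 * pi * znorm m) `^ (2 * alpha).

Definition frac_laplacian (alpha : R) (phi : 'rV[R]_d -> C) : 'rV[R]_d -> C :=
  fun x => zsum (fun m => (fl_symbol alpha m)%:C * fourier phi m * ex m x).

Definition heat (alpha t : R) (T : functional) : functional :=
  fseries (fun m => (expR (- t * fl_symbol alpha m))%:C * fcoef T m).

(* At m = 0 the subtracted term is 0 and the mean is left unchanged. *)
Definition leray (f : 'I_d -> functional) (i : 'I_d) : functional :=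
  fseries (fun m => fcoef (f i) m -
    (m 0 i)%:~R * (\sum_j (m 0 j)%:~R * fcoef (f j) m) / (znorm m ^+ 2)%:C).

Definition divergence (A : 'I_d -> 'I_d -> functional) (i : 'I_d) : functional :=
  fun phi => - \sum_j A i j (partial j phi).

End Fourier.

Section Paraproduct.
Context {R : realType} {d : nat}.
Variable chi : 'rV[R]_d -> R.
Local Notation C := R[i].
Local Notation functional := (('rV[R]_d -> C) -> C).

(* Littlewood-Paley projections, indexed by k with dyadic integer N = 2^k *)
Definition Ple (k : nat) (T : functional) : 'rV[R]_d -> C :=
  fun x => zsum (fun m =>
    (chi ((2 ^+ k)^-1 *: ivec m))%:C * fcoef T m * ex m x).

Definition P_ (k : nat) (T : functional) : 'rV[R]_d -> C :=
  if k is k'.+1 then fun x => Ple k'.+1 T x - Ple k' T x else Ple 0 T.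

Definition Hnorm (s : R) (c : 'I_d -> 'I_d -> 'rV[int]_d -> C) : \bar R :=
  poweR (\esum_(m in [set m : 'rV[int]_d | m != 0])
           (znorm m `^ (2 * s) * \sum_i \sum_j complex.Re `|c i j m| ^+ 2)%:E)
        2^-1.

(* Fourier coefficients of P_N u (x) P_M u, for N = 2^k and M = 2^l *)
Definition LPtensor (u : 'I_d -> functional) (k l : nat)
    (i j : 'I_d) : 'rV[int]_d -> C :=
  fourier (fun x => P_ k (u i) x * P_ l (u j) x).

Definition para_summable (s : R) (u : 'I_d -> functional) : Prop :=
  (\esum_(p in [set: nat * nat]) Hnorm (- s) (LPtensor u p.1 p.2) < +oo)%E.

(* u (x) u is well-defined as a paraproduct in H^{-s} and w is its value, i.e.
   the mean-zero representative of the sum of the series in H^{-s}. *)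
Definition paraproduct (s : R) (u : 'I_d -> functional)
    (w : 'I_d -> 'I_d -> functional) : Prop :=
  [/\ para_summable s u,
      forall i j, distribution (w i j) /\ fcoef (w i j) 0 = 0,
      (Hnorm (- s) (fun i j => fcoef (w i j)) < +oo)%E &
      (fun n : nat => Hnorm (- s) (fun i j m => fcoef (w i j) m -
         \sum_(k < n) \sum_(l < n) LPtensor u k l i j m)) @ \oo --> 0%E].

Definition singular_solution (alpha : R) (u : 'I_d -> functional) : Prop :=
  [/\ forall i, distribution (u i) /\ fcoef (u i) 0 = 0,
      divergence_free u &
      exists s : R, 0 < s /\ exists w, paraproduct s u w /\
        forall phi : 'I_d -> 'rV[R]_d -> C,
          (forall i, test (phi i)) ->
          (forall x, \sum_i partial i (phi i) x = 0) ->
          - (\sum_i \sum_j w i j (partial j (phi i)))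
          + \sum_i u i (frac_laplacian alpha (phi i)) = 0].

End Paraproduct.

Section SpaceTime.
Context {R : realType} {d : nat}.
Local Notation C := R[i].
Local Notation functional := (('rV[R]_d -> C) -> C).
Variable T : \bar R.

(* Functions on R x T^d are functions on 'rV[R]_(1 + d), time coming first. *)
Definition slice (Phi : 'rV[R]_(1 + d) -> C) (t : R) : 'rV[R]_d -> C :=
  fun x => Phi (row_mx t%:M x).

Definition time_supp (a b : R) (Phi : 'rV[R]_(1 + d) -> C) : Prop :=
  forall t x, slice Phi t x != 0 -> a <= t <= b.

(* C_c^oo((0,T) x T^d) *)
Definition st_test (Phi : 'rV[R]_(1 + d) -> C) : Prop :=
  [/\ smooth Phi, forall t, periodic (slice Phi t) &
      exists a b : R, [/\ 0 < a, (b%:E < T)%E & time_supp a b Phi]].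

(* Continuity on each C_c^oo([a,b] x T^d) with [a,b] in (0,T). *)
Definition st_distribution (F : ('rV[R]_(1 + d) -> C) -> C) : Prop :=
  [/\ forall (c : C) Phi Psi, st_test Phi -> st_test Psi ->
        F (fun z => c * Phi z + Psi z) = c * F Phi + F Psi &
      forall a b : R, 0 < a -> (b%:E < T)%E ->
        exists (K : R) (k : nat), forall Phi (B : R),
          st_test Phi -> time_supp a b Phi ->
          (forall l : seq 'I_(1 + d), (size l <= k)%N ->
             forall z, `|partials l Phi z| <= B%:C) ->
          `|F Phi| <= (K * B)%:C].

Definition time_interval : set R := [set t | 0 < t /\ (t%:E < T)%E].

(* The space-time functional of a family t |-> F t of functionals on T^d. *)
Definition st_pair (F : R -> functional) (Phi : 'rV[R]_(1 + d) -> C) : C :=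
  cintegral time_interval (fun t => F t (slice Phi t)).

Definition st_family (F : R -> functional) : Prop :=
  (forall Phi, st_test Phi ->
     cintegrable time_interval (fun t => F t (slice Phi t))) /\
  st_distribution (st_pair F).

End SpaceTime.

Section Mild.
Context {R : realType} {d : nat}.
Local Notation C := R[i].
Local Notation functional := (('rV[R]_d -> C) -> C).

Definition duhamel_integrand (alpha : R) (W : R -> 'I_d -> 'I_d -> functional)
    (t : R) (i : 'I_d) (s : R) : functional :=
  heat alpha (t - s) (leray (divergence (W s)) i).

(* B_alpha(U,U)(t), where W s is the paraproduct (U (x) U)(s); the integral in
   s is a weak integral of distributions. *)
Definition duhamel (alpha : R) (W : R -> 'I_d -> 'I_d -> functional)
    (t : R) (i : 'I_d) : functional :=
  fun phi => cintegral `]0, t[ (fun s => duhamel_integrand alpha W t i s phi).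

Definition mild_solution (chi : 'rV[R]_d -> R) (alpha : R) (T : \bar R)
    (u_in : 'I_d -> functional) (U : R -> 'I_d -> functional) : Prop :=
  [/\ (0 < T)%E,
      forall i, distribution (u_in i),
      divergence_free u_in,
      forall t i, time_interval T t -> distribution (U t i) &
      exists W : R -> 'I_d -> 'I_d -> functional,
        [/\ forall t, time_interval T t ->
              exists s : R, 0 < s /\ paraproduct chi s (U t) (W t),
            forall t i phi, time_interval T t -> test phi ->
              cintegrable `]0, t[
                (fun s => duhamel_integrand alpha W t i s phi),
            forall i, [/\ st_family T (fun t => U t i),
                          st_family T (fun t => heat alpha t (u_in i)) &
                          st_family T (fun t => duhamel alpha W t i)] &
            forall i Phi, st_test T Phi ->
              st_pair T (fun t => U t i) Phi =
              st_pair T (fun t => heat alpha t (u_in i)) Phi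
              - st_pair T (fun t => duhamel alpha W t i) Phi]].

(* 1_{(0,oo)}(t) (x) u(x) *)
Definition stationary (u : 'I_d -> functional) : R -> 'I_d -> functional :=
  fun t i phi => (\1_(`]0, +oo[%classic : set R) t)%:C * u i phi.

End Mild.

(* Main.v *)
Require Import Defs.
From HB Require Import structures.
From mathcomp Require Import all_boot all_order all_algebra.
From mathcomp Require Import complex.
From mathcomp Require Import ring lra zify.
From mathcomp Require Import all_classical all_reals all_analysis.
From mathcomp Require Import measurable_realfun.
Set Implicit Arguments.
Unset Strict Implicit.
Unset Printing Implicit Defensive.
Import Order.TTheory GRing.Theory Num.Theory.
Import numFieldNormedType.Exports.
Import ComplexField.Normc.
Local Open Scope classical_set_scope.
Local Open Scope ring_scope.
Local Open Scope complex_scope.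

(** A steady state is a fixed point of the Duhamel formula, and on the Fourier
    side the computation takes one line. Testing the stationary equation against
    the divergence-free fields [x |-> a e^(-2 pi i m.x)], with [a] orthogonal to
    [m], shows that the Leray projection of [div (u (x) u)] has coefficients
    [- lam(m) u^(m)], where [lam(m) = (2 pi |m|)^(2 alpha)] (lemma [leray_coef]).
    Since the integral of [lam e^(-(t-s) lam)] over [0 < s < t] is
    [1 - e^(-t lam)], the bilinear term at time [t] has coefficients
    [(e^(-t lam) - 1) u^(m)] (lemma [duhamelE]), and subtracting it from
    [e^(-t lam) u^(m)] leaves [u^(m)] (lemma [stationary_duhamel]).

    The work lies in showing that these series represent the distributions in
    question. That needs Fourier inversion for smooth periodic functions on R^d,
    together with all derivatives, for coefficients given by iterated Lebesgue
    integrals. It is obtained from the discrete Fourier transform. On the grid of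
    mesh 1/(2n+1) inversion is an exact finite identity whose frequencies are
    those of the box {-n,..,n}^d ([dft_inversion]). The discrete coefficients
    decay rapidly, uniformly in n, because a difference of mesh 1/N multiplies
    them by [e^(2 pi i m_j / N) - 1], of size at least [|m_j| / N] on the box
    ([dft_decay]). They converge to the Fourier coefficients, because a Lipschitz
    function has convergent grid averages ([rcube_avg_le]). Tannery's theorem
    ([tannery]) lets n tend to infinity in the identity ([fourier_inversion]).
    The rule for coefficients of derivatives ([fourier_partial]) comes from the
    same difference factor. Rapid decay then makes Fourier sums converge in every
    C^k norm, so a distribution is the sum of its Fourier series
    ([dist_fourier]).

    The three families [t |-> u], [t |-> e^(-t (-Delta)^alpha) u] and the bilinear
    term are Fourier multipliers applied to [u], with multipliers [1],
    [e^(-t lam)] and [e^(-t lam) - 1] of modulus at most 1. One argument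
    ([multiplier_st_family]) shows that every such family is integrable against
    space-time test functions and defines a space-time distribution; measurability
    in time comes once more from grid averages. *)

(** * Moduli and limits of complex sequences *)

Section ComplexModulus.
Context {R : realType}.
Local Notation C := R[i].
Implicit Types z w : C.

Lemma cReD z w : complex.Re (z + w) = complex.Re z + complex.Re w.
Proof. by case: z; case: w. Qed.

Lemma cImD z w : complex.Im (z + w) = complex.Im z + complex.Im w.
Proof. by case: z; case: w. Qed.

Lemma cReN z : complex.Re (- z) = - complex.Re z.
Proof. by case: z. Qed.

Lemma cImN z : complex.Im (- z) = - complex.Im z.
Proof. by case: z. Qed.

Lemma cReM z w : complex.Re (z * w)
  = complex.Re z * complex.Re w - complex.Im z * complex.Im w.
Proof. by case: z; case: w. Qed.

Lemma cImM z w : complex.Im (z * w)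
  = complex.Re z * complex.Im w + complex.Im z * complex.Re w.
Proof. by case: z; case: w. Qed.

Lemma cRe_sum (I : Type) (r : seq I) (P : pred I) (F : I -> C) :
  complex.Re (\sum_(i <- r | P i) F i) = \sum_(i <- r | P i) complex.Re (F i).
Proof. by apply: (big_morph (@complex.Re R)) => //; apply: cReD. Qed.

Lemma cIm_sum (I : Type) (r : seq I) (P : pred I) (F : I -> C) :
  complex.Im (\sum_(i <- r | P i) F i) = \sum_(i <- r | P i) complex.Im (F i).
Proof. by apply: (big_morph (@complex.Im R)) => //; apply: cImD. Qed.

Lemma complex_ext z w :
  complex.Re z = complex.Re w -> complex.Im z = complex.Im w -> z = w.
Proof. by case: z => a b; case: w => c e /= -> ->. Qed.

Lemma normcE z : `|z| = (normc z)%:C.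
Proof. by []. Qed.

Lemma normc_leP z (b : R) : (`|z| <= b%:C) = (normc z <= b).
Proof. by rewrite normcE lecR. Qed.

Lemma normc_ge0 z : 0 <= normc z.
Proof. by case: z => a b; apply: sqrtr_ge0. Qed.

Lemma ler_normcD z w : normc (z + w) <= normc z + normc w.
Proof. by have := ler_normD z w; rewrite !normcE -rmorphD lecR. Qed.

Lemma normcN z : normc (- z) = normc z.
Proof. by case: z => a b /=; rewrite !sqrrN. Qed.

Lemma normcB z w : normc (z - w) = normc (w - z).
Proof. by rewrite -normcN opprB. Qed.

Lemma ler_normc_sum (I : Type) (r : seq I) (P : pred I) (F : I -> C) :
  normc (\sum_(i <- r | P i) F i) <= \sum_(i <- r | P i) normc (F i).
Proof.
elim/big_ind2: _ => //; first by rewrite normc0.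
by move=> x1 y1 x2 y2 h1 h2; apply: le_trans (ler_normcD _ _) (lerD h1 h2).
Qed.

Lemma Re_le_normc z : `|complex.Re z| <= normc z.
Proof. by rewrite -lecR -normcE; apply: normc_ge_Re. Qed.

Lemma Im_le_normc z : `|complex.Im z| <= normc z.
Proof.
case: z => a b /=; rewrite -(sqrtr_sqr b) ler_sqrt ?lerDr ?sqr_ge0 //.
by rewrite addr_ge0 ?sqr_ge0.
Qed.

Lemma normc_le_ReIm z : normc z <= `|complex.Re z| + `|complex.Im z|.
Proof.
case: z => a b /=.
rewrite -[leRHS]ger0_norm ?addr_ge0 // -sqrtr_sqr ler_sqrt ?sqr_ge0 //.
by rewrite sqrrD !real_normK ?num_real // lerD2r lerDl mulrn_wge0 // mulr_ge0.
Qed.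

Lemma normcR (a : R) : normc a%:C = `|a|.
Proof. by rewrite /= expr0n /= addr0 sqrtr_sqr. Qed.

Lemma normc_nat n : normc (n%:R : C) = n%:R.
Proof. by rewrite -(rmorph_nat (real_complex R)) normcR normr_nat. Qed.

Lemma normcX z n : normc (z ^+ n) = normc z ^+ n.
Proof.
elim: n => [|n IH]; first by rewrite !expr0 normc1.
by rewrite !exprS normcM IH.
Qed.

Lemma real_complexE (a : R) z :
  a%:C * z = (a * complex.Re z) +i* (a * complex.Im z).
Proof. by case: z => x y; simpc. Qed.

(** Tested on real and imaginary parts, since these are the limits that [clim]
    takes. *)
Definition ccvg (u : nat -> C) (l : C) : Prop :=
  (fun n => complex.Re (u n)) @ \oo --> complex.Re l /\
  (fun n => complex.Im (u n)) @ \oo --> complex.Im l.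

Lemma ccvg_clim u l : ccvg u l -> clim u = l.
Proof.
by case=> h1 h2; rewrite /clim (cvg_lim _ h1) // (cvg_lim _ h2) //; case: (l).
Qed.

Lemma ccvg_unique u l l' : ccvg u l -> ccvg u l' -> l = l'.
Proof. by move=> /ccvg_clim <- /ccvg_clim. Qed.

Lemma ccvg_cst l : ccvg (fun=> l) l.
Proof. by split; apply: cvg_cst. Qed.

Lemma ccvg_near u v l : (\forall n \near \oo, u n = v n) -> ccvg u l ->
  ccvg v l.
Proof.
move=> uv [h1 h2]; split.
  by apply: cvg_trans h1; apply: near_eq_cvg; apply: filterS uv => n ->.
by apply: cvg_trans h2; apply: near_eq_cvg; apply: filterS uv => n ->.
Qed.

Lemma ccvgD u v l l' : ccvg u l -> ccvg v l' ->
  ccvg (fun n => u n + v n) (l + l').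
Proof.
move=> [h1 h2] [h3 h4]; split.
  rewrite cReD; under eq_fun do rewrite cReD; exact: cvgD.
by rewrite cImD; under eq_fun do rewrite cImD; exact: cvgD.
Qed.

Lemma ccvgM u v l l' : ccvg u l -> ccvg v l' ->
  ccvg (fun n => u n * v n) (l * l').
Proof.
move=> [h1 h2] [h3 h4]; split.
  rewrite cReM; under eq_fun do rewrite cReM.
  by apply: cvgB; apply: cvgM.
rewrite cImM; under eq_fun do rewrite cImM.
by apply: cvgD; apply: cvgM.
Qed.

Lemma ccvgZ (a : C) u l : ccvg u l -> ccvg (fun n => a * u n) (a * l).
Proof. by apply: ccvgM; apply: ccvg_cst. Qed.

Lemma ccvg_sum (I : Type) (r : seq I) (u : I -> nat -> C) (l : I -> C) :
  (forall i, ccvg (u i) (l i)) ->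
  ccvg (fun n => \sum_(i <- r) u i n) (\sum_(i <- r) l i).
Proof.
move=> h; elim: r => [|i r IH].
  by rewrite big_nil; under eq_fun do rewrite big_nil; apply: ccvg_cst.
by rewrite big_cons; under eq_fun do rewrite big_cons; apply: ccvgD.
Qed.

Lemma ccvg_dist u l : ccvg u l <-> (fun n => normc (u n - l)) @ \oo --> 0.
Proof.
split=> [[h1 h2]|h].
  have h0 : (fun n => `|complex.Re (u n) - complex.Re l|
                    + `|complex.Im (u n) - complex.Im l|) @ \oo --> 0 + 0.
    apply: cvgD.
      by apply/norm_cvg0P/subr_cvg0.
    by apply/norm_cvg0P/subr_cvg0.
  rewrite addr0 in h0.
  apply: (squeeze_cvgr _ (cvg_cst 0) h0); near=> n.
  rewrite normc_ge0 /=; apply: le_trans (normc_le_ReIm _) _.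
  by rewrite cReD cImD cReN cImN.
split; apply/subr_cvg0/norm_cvg0P; apply: (squeeze_cvgr _ (cvg_cst 0) h);
  near=> n; rewrite normr_ge0 /=.
  by rewrite -cReN -cReD Re_le_normc.
by rewrite -cImN -cImD Im_le_normc.
Unshelve. all: by end_near. Qed.

Lemma ccvg_le u l (e : nat -> R) : e @ \oo --> 0 ->
  (forall n, normc (u n - l) <= e n) -> ccvg u l.
Proof.
move=> e0 h; apply/ccvg_dist; apply: (squeeze_cvgr _ (cvg_cst 0) e0).
by near=> n; rewrite normc_ge0 h.
Unshelve. all: by end_near. Qed.

Lemma ccvg_normc u l : ccvg u l -> (fun n => normc (u n)) @ \oo --> normc l.
Proof.
move=> /ccvg_dist h; apply/subr_cvg0/norm_cvg0P.
apply: (squeeze_cvgr _ (cvg_cst 0) h); near=> n; rewrite normr_ge0 /= ler_norml.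
have h1 := ler_normcD (u n - l) l; rewrite subrK in h1.
have h2 := ler_normcD (l - u n) (u n); rewrite subrK normcB in h2.
by apply/andP; split; lra.
Unshelve. all: by end_near. Qed.

Lemma ccvg_normc_le u l (b : R) : ccvg u l ->
  (\forall n \near \oo, normc (u n) <= b) -> normc l <= b.
Proof. by move=> /ccvg_normc h hb; apply: (cvgr_to_le h). Qed.

End ComplexModulus.

(** * Summation over boxes of Z^d *)

Section Boxes.
Context {R : realType} {d : nat}.
Local Notation C := R[i].
Local Notation Z := 'rV[int]_d.
Implicit Types (m : Z) (n : nat).

Definition box_pt n (k : {ffun 'I_d -> 'I_(n.*2.+1)}) : Z :=
  \row_i ((k i)%:Z - n%:Z).

Definition box n : seq Z := [seq box_pt k | k : {ffun 'I_d -> 'I_(n.*2.+1)}].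

Definition bsum (c : Z -> C) n : C := \sum_(m <- box n) c m.

Lemma big_box (T : nmodType) (F : Z -> T) n :
  \sum_(m <- box n) F m = \sum_(k : {ffun 'I_d -> 'I_(n.*2.+1)}) F (box_pt k).
Proof. by rewrite /box big_image. Qed.

Lemma zsumE (c : Z -> C) : zsum c = clim (bsum c).
Proof. by congr clim; apply/funext => n; rewrite /bsum big_box. Qed.

Lemma box_pt_inj n : injective (@box_pt n).
Proof.
move=> k k' /rowP h; apply/ffunP => i; apply/val_inj => /=.
by move: (h i); rewrite !mxE => /addIr [].
Qed.

Lemma box_uniq n : uniq (box n).
Proof. by rewrite map_inj_uniq ?enum_uniq //; apply: box_pt_inj. Qed.

Lemma mem_box m n : (m \in box n) = [forall i, (`|m 0%R i| <= n)%N].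
Proof.
apply/fintype.imageP/forallP => [[k _ ->] i|h].
  by rewrite mxE; move: (ltn_ord (k i)); move: (nat_of_ord (k i)) => a; lia.
have lt i : (`|(m 0 i + n%:Z)%R|%N < n.*2.+1)%N.
  by have := h i; lia.
exists [ffun i => Ordinal (lt i)] => //.
by apply/rowP => i; rewrite mxE ffunE /=; have := h i; lia.
Qed.

Lemma subset_box n n' : (n <= n')%N -> {subset box n <= box n'}.
Proof.
move=> nn' m; rewrite !mem_box => /forallP h; apply/forallP => i.
exact: leq_trans (h i) nn'.
Qed.

Lemma big_box_split (T : nmodType) (F : Z -> T) n n' : (n <= n')%N ->
  \sum_(m <- box n') F m
  = \sum_(m <- box n) F m + \sum_(m <- box n' | m \notin box n) F m.
Proof.
move=> nn'; rewrite (bigID (mem (box n))) /=; congr (_ + _).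
rewrite -big_filter; apply: perm_big; apply: uniq_perm.
- by rewrite filter_uniq ?box_uniq.
- exact: box_uniq.
move=> m; rewrite mem_filter; apply: andb_idr; exact: subset_box.
Qed.

Lemma mem_box_near m : \forall n \near \oo, m \in box n.
Proof.
exists (\max_i `|m 0%R i|)%N => // n /= h; rewrite mem_box.
by apply/forallP => i; apply: leq_trans h; apply: leq_bigmax.
Qed.

(** The product form makes the sums over boxes powers of one-dimensional sums,
    whence summability over Z^d. *)
Definition weight m : R := \prod_i ((1 + `|m 0%R i|%N)%:R ^- 2).

Lemma weight_gt0 m : 0 < weight m.
Proof. by apply: prodr_gt0 => i _; rewrite invr_gt0 exprn_gt0 ?ltr0n. Qed.

Let weight_ge0 m : 0 <= weight m := ltW (weight_gt0 m).

Definition wsum n : R := \sum_(m <- box n) weight m.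

(** Telescoping: the summand at [a] is at most [2 / (a + 1) - 2 / (a + 2)]. *)
Lemma inv_sqr_sum_le n : \sum_(a < n) ((1 + a)%:R ^- 2 : R) <= 2 - 2 / n.+1%:R.
Proof.
elim: n => [|n IH]; first by rewrite big_ord0 divr1 subrr.
rewrite big_ord_recr /=; apply: le_trans (lerD IH (lexx _)) _.
have x0 : 0 < (n.+1%:R : R) by rewrite ltr0n.
rewrite add1n -[n.+2]addn1 natrD; set x := n.+1%:R : R.
rewrite -/x in x0; rewrite -subr_ge0.
have -> : 2 - 2 / (x + 1%:R) - (2 - 2 / x + x ^- 2)
  = (x - 1) / (x ^+ 2 * (x + 1%:R)).
  by field; rewrite !gt_eqF //; lra.
rewrite divr_ge0 ?mulr_ge0 ?exprn_ge0 //; try lra.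
by rewrite subr_ge0 ler1n.
Qed.

Lemma inv_sqr_box_le n :
  \sum_(a < n.*2.+1) ((1 + `|a%:Z - n%:Z|%N)%:R ^- 2 : R) <= 4.
Proof.
rewrite -(big_mkord xpredT (fun a : nat => (1 + `|a%:Z - n%:Z|%N)%:R ^- 2 : R)).
rewrite (@big_cat_nat _ _ _ n.+1) //=; last by lia.
have half k : \sum_(a < k) ((1 + a)%:R ^- 2 : R) <= 2.
  apply: le_trans (inv_sqr_sum_le k) _.
  by rewrite lerBlDr lerDl divr_ge0.
rewrite [leRHS](_ : _ = 2 + 2) //; last by rewrite -natrD.
apply: lerD.
  rewrite big_mkord (reindex_inj rev_ord_inj) /=.
  rewrite (eq_bigr (fun a : 'I_n.+1 => (1 + a)%:R ^- 2 : R)) => [|a _].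
    exact: half.
  congr (_ ^- 2); congr (_ %:R); have := ltn_ord a.
  by move: (nat_of_ord a) => k /=; lia.
rewrite -{1}[n.+1]add0n big_addn big_mkord.
apply: le_trans (half (n.*2.+1 - n.+1)%N); apply: ler_sum => a _.
rewrite lef_pV2 ?posrE ?exprn_gt0 ?ltr0n // lerXn2r ?nnegrE ?ler0n //.
by rewrite ler_nat; lia.
Qed.

Lemma wsum_le n : wsum n <= 4 ^+ d.
Proof.
rewrite /wsum big_box /weight.
under eq_bigr => k _ do under eq_bigr => i _ do rewrite mxE.
rewrite -(bigA_distr_bigA
  (fun (i : 'I_d) (a : 'I_n.*2.+1) => (1 + `|a%:Z - n%:Z|%N)%:R ^- 2 : R)) /=.
rewrite -[X in _ <= _ ^+ X]card_ord -prodr_const.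
by apply: ler_prod => i _; rewrite inv_sqr_box_le andbT sumr_ge0 // => a _;
  rewrite invr_ge0 exprn_ge0.
Qed.

Lemma wsum_ge0 n : 0 <= wsum n.
Proof. exact: sumr_ge0. Qed.

Lemma wsum_mono : {homo wsum : n n' / (n <= n')%N >-> n <= n'}.
Proof. by move=> n n' nn'; rewrite /wsum (big_box_split _ nn') lerDl sumr_ge0. Qed.

Definition wlim : R := lim (wsum @ \oo).

Lemma wsum_cvg : wsum @ \oo --> wlim.
Proof.
apply: nondecreasing_is_cvgn; first by move=> n n'; apply: wsum_mono.
by exists (4 ^+ d) => _ [n _ <-]; apply: wsum_le.
Qed.

Lemma wsum_le_lim n : wsum n <= wlim.
Proof.
apply: (cvgr_to_ge wsum_cvg); exists n => // k /= nk; exact: wsum_mono.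
Qed.

Lemma wlim_ge0 : 0 <= wlim.
Proof. exact: le_trans (wsum_ge0 0) (wsum_le_lim 0). Qed.

Lemma wtail_cvg (K : R) : (fun n => K * (wlim - wsum n)) @ \oo --> 0.
Proof.
rewrite -[X in _ --> X](mulr0 K) -(subrr wlim).
by apply: cvgMr; apply: cvgB; [apply: cvg_cst|apply: wsum_cvg].
Qed.

Lemma zsum_eq (c c' : Z -> C) : (forall m, c m = c' m) -> zsum c = zsum c'.
Proof. by move=> h; congr zsum; apply/funext. Qed.

Lemma zsum_supp1 (c : Z -> C) m : (forall m', m' != m -> c m' = 0) ->
  zsum c = c m.
Proof.
move=> h; rewrite zsumE; apply: ccvg_clim; apply: ccvg_near (ccvg_cst (c m)).
apply: filterS (mem_box_near m) => n mn; rewrite /bsum (bigD1_seq m) ?box_uniq //=.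
by rewrite big1 ?addr0.
Qed.

Section Dominated.
Variables (c : Z -> C) (K : R).
Hypothesis cK : forall m, normc (c m) <= K * weight m.

Lemma dominated_ge0 : 0 <= K.
Proof.
have := le_trans (normc_ge0 _) (cK 0).
by rewrite pmulr_lge0 ?weight_gt0.
Qed.

Lemma bsum_diff_le n n' : (n <= n')%N ->
  normc (bsum c n' - bsum c n) <= K * (wsum n' - wsum n).
Proof.
move=> nn'; rewrite /bsum /wsum !(big_box_split _ nn') !(addrC (\sum_(m <- box n) _)).
rewrite !addrK mulr_sumr; apply: le_trans (ler_normc_sum _ _ _) _.
by apply: ler_sum => m _; apply: cK.
Qed.

Lemma bsum_le n : normc (bsum c n) <= K * wsum n.
Proof.
rewrite /bsum /wsum mulr_sumr; apply: le_trans (ler_normc_sum _ _ _) _.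
by apply: ler_sum => m _; apply: cK.
Qed.

(** Adding [K * wsum n] to the real and imaginary parts of the partial sums
    makes them monotone and bounded. *)
Lemma bsum_cvg : ccvg (bsum c) (zsum c).
Proof.
have K0 := dominated_ge0.
have key (p : C -> R) : (forall z w, p (z + w) = p z + p w) ->
    (forall z, p (- z) = - p z) -> (forall z, `|p z| <= normc z) ->
    exists l : R, (fun n => p (bsum c n)) @ \oo --> l.
  move=> pD pN ple.
  have mono : nondecreasing_seq (fun n => p (bsum c n) + K * wsum n).
    move=> n n' nn'; rewrite -subr_ge0.
    have := le_trans (ple _) (bsum_diff_le nn').
    by rewrite pD pN ler_norml mulrBr => /andP[h _]; lra.
  have bd : has_ubound (range (fun n => p (bsum c n) + K * wsum n)).
    exists (K * wlim + K * wlim) => _ [n _ <-].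
    have h1 := le_trans (ler_norm _) (le_trans (ple _) (bsum_le n)).
    have h2 := ler_wpM2l K0 (wsum_le_lim n).
    by rewrite lerD //; apply: le_trans h2.
  have hc := nondecreasing_is_cvgn mono bd.
  have hw : (fun n => K * wsum n) @ \oo --> K * wlim.
    by apply: cvgMr; apply: wsum_cvg.
  exists (lim ((fun n => p (bsum c n) + K * wsum n) @ \oo) - K * wlim).
  have -> : (fun n => p (bsum c n))
      = (fun n => p (bsum c n) + K * wsum n) - (fun n => K * wsum n).
    by apply/funext => n; rewrite [RHS]addrK.
  exact: cvgB hc hw.
have [a ha] := key (@complex.Re R) cReD cReN Re_le_normc.
have [b hb] := key (@complex.Im R) cImD cImN Im_le_normc.
have h : ccvg (bsum c) (a +i* b) by split.
by rewrite zsumE (ccvg_clim h).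
Qed.

Lemma zsum_tail_le n : normc (zsum c - bsum c n) <= K * (wlim - wsum n).
Proof.
have h : ccvg (fun k => bsum c k - bsum c n) (zsum c - bsum c n).
  by apply: ccvgD; [exact: bsum_cvg|exact: ccvg_cst].
apply: (ccvg_normc_le h); exists n => // k /= nk.
apply: le_trans (bsum_diff_le nk) _.
by rewrite ler_wpM2l ?dominated_ge0 // lerD2r wsum_le_lim.
Qed.

Lemma zsum_le : normc (zsum c) <= K * wlim.
Proof.
apply: (ccvg_normc_le bsum_cvg); near=> n; apply: le_trans (bsum_le n) _.
by rewrite ler_wpM2l ?dominated_ge0 // wsum_le_lim.
Unshelve. all: by end_near. Qed.

End Dominated.

(** Tannery's theorem: the terms may depend on the box, as long as one
    summable weight dominates them. *)
Lemma tannery (a : nat -> Z -> C) (c : Z -> C) (K : R) :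
  (forall n m, m \in box n -> normc (a n m) <= K * weight m) ->
  (forall m, ccvg (a ^~ m) (c m)) ->
  ccvg (fun n => \sum_(m <- box n) a n m) (zsum c).
Proof.
move=> aK ac.
have cK m : normc (c m) <= K * weight m.
  apply: (ccvg_normc_le (ac m)).
  by apply: filterS (mem_box_near m) => n; apply: aK.
have K0 := dominated_ge0 cK.
apply/ccvg_dist/cvgrPdist_lt => e e0.
have e4 : 0 < e / 4 by rewrite divr_gt0.
(* Outside the box of radius M both the sum and the series are below e / 4. *)
have /cvgrPdist_lt/(_ _ e4) [M _ hM] := wtail_cvg K.
have {}hM : K * (wlim - wsum M) < e / 4.
  by apply: le_lt_trans (hM M (leqnn _)); rewrite sub0r normrN ler_norm.
have hfin : ccvg (fun n => \sum_(m <- box M) a n m) (bsum c M).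
  exact: ccvg_sum.
have /ccvg_dist/cvgrPdist_lt/(_ _ e4) hfin' := hfin.
near=> n; rewrite sub0r normrN ger0_norm ?normc_ge0 //.
have Mn : (M <= n)%N by near: n; exists M.
rewrite (big_box_split _ Mn).
have : `|0 - normc (\sum_(m <- box M) a n m - bsum c M)| < e / 4.
  by near: n.
rewrite sub0r normrN ger0_norm ?normc_ge0 //.
set A := \sum_(m <- box M) _; set T := \sum_(m <- box n | _) _ => hA.
have hT : normc T <= K * (wlim - wsum M).
  apply: le_trans (ler_normc_sum _ _ _) _.
  apply: (@le_trans _ _ (K * (wsum n - wsum M))).
    rewrite /wsum (big_box_split _ Mn) addrC addKr mulr_sumr.
    rewrite big_seq_cond [leRHS]big_seq_cond.
    by apply: ler_sum => m /andP[mn _]; apply: aK.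
  by rewrite ler_wpM2l // lerD2r wsum_le_lim.
have hz := zsum_tail_le cK M; rewrite normcB in hz.
have -> : A + T - zsum c = (A - bsum c M) + (T + (bsum c M - zsum c)) by ring.
have := ler_normcD (A - bsum c M) (T + (bsum c M - zsum c)).
have := ler_normcD T (bsum c M - zsum c).
by lra.
Unshelve. all: by end_near. Qed.

End Boxes.

(** * The iterated integral as a limit of grid averages *)

Section RiemannSums.
Context {R : realType}.
Local Notation C := R[i].
Local Notation mu := (@lebesgue_measure R).

Lemma lipschitz1_continuous (G : R -> R) (L : R) :
  (forall s t, `|G s - G t| <= L * `|s - t|) -> continuous G.
Proof.
move=> lipG x; apply/cvgrPdist_lt => e e0.
have L0 : 0 <= L.
  have := le_trans (normr_ge0 _) (lipG 1 0).
  by rewrite subr0 normr1 mulr1.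
have L1 : 0 < L + 1 by rewrite ltr_wpDl.
near=> y; apply: le_lt_trans (lipG x y) _.
have xy : `|x - y| < e / (L + 1).
  by near: y; apply: cvgr_dist_lt => //; rewrite divr_gt0.
apply: (@le_lt_trans _ _ ((L + 1) * `|x - y|)).
  by rewrite ler_wpM2r // lerDl.
by rewrite mulrC -ltr_pdivlMr.
Unshelve. all: by end_near. Qed.

(** The mean value theorem for a primitive turns each subinterval's share of
    the integral into a value of the integrand in that subinterval. *)
Lemma riemann_sum1 (G : R -> R) (L : R) N : (0 < N)%N ->
  (forall s t, `|G s - G t| <= L * `|s - t|) ->
  `|\int[mu]_(t in `[0, 1]) G t - N%:R^-1 * \sum_(k < N) G (k%:R / N%:R)|
    <= L / N%:R.
Proof.
move=> N0 lipG; have cG := lipschitz1_continuous lipG.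
have L0 : 0 <= L.
  have := le_trans (normr_ge0 _) (lipG 1 0).
  by rewrite subr0 normr1 mulr1.
have Ngt0 : 0 < (N%:R : R) by rewrite ltr0n.
(* The primitive starts at -1, so that 0 and 1 are interior points. *)
pose F (x : R) : R := \int[mu]_(t in `[-1, x]) G t.
have FG (x : R) : -1 < x < 2 -> derivable F x 1 /\ derive1 F x = G x.
  move=> /andP[x1 x2]; apply: (@continuous_FTC1_closed _ _ _ _ 2) => //; last exact: cG.
  apply: continuous_compact_integrable; first exact: segment_compact.
  exact: continuous_subspaceT.
have cF (x : R) : -1 < x < 2 -> {for x, continuous F}.
  move=> /FG[dF _].
  by apply: differentiable_continuous; rewrite -derivable1_diffP.
have intG : \int[mu]_(t in `[0, 1]) G t = F 1 - F 0.
  rewrite /Rintegral (@continuous_FTC2 _ G F) //.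
  - exact: continuous_subspaceT.
  - split.
    + move=> x; rewrite in_itv /= => /andP[h1 h2].
      by apply: (FG x _).1; apply/andP; split; lra.
    + by apply: cvg_at_right_filter; apply: cF; apply/andP; split; lra.
    + by apply: cvg_at_left_filter; apply: cF; apply/andP; split; lra.
  move=> x; rewrite in_itv /= => /andP[h1 h2].
  by apply: (FG x _).2; apply/andP; split; lra.
have tele : F 1 - F 0 = \sum_(k < N) (F (k.+1%:R / N%:R) - F (k%:R / N%:R)).
  rewrite -(big_mkord xpredT (fun k => F (k.+1%:R / N%:R) - F (k%:R / N%:R))).
  rewrite (telescope_sumr (fun k => F (k%:R / N%:R))) // mul0r divff //.
  by rewrite gt_eqF.
rewrite intG tele mulr_sumr -sumrB.
apply: le_trans (ler_norm_sum _ _ _) _.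
rewrite (_ : L / N%:R = \sum_(k < N) (L / N%:R / N%:R)); last first.
  rewrite sumr_const card_ord -[RHS]mulr_natr divfK //.
  by rewrite gt_eqF.
apply: ler_sum => k _.
have kN : (k.+1%:R : R) <= N%:R by rewrite ler_nat.
have kk : (k%:R : R) / N%:R < k.+1%:R / N%:R by rewrite ltr_pM2r ?invr_gt0 // ltr_nat.
have a0 : 0 <= (k%:R : R) / N%:R by rewrite divr_ge0.
have b1 : (k.+1%:R : R) / N%:R <= 1 by rewrite ler_pdivrMr ?mul1r.
have [||c] := @MVT _ F G _ _ kk.
- move=> x; rewrite in_itv /= => /andP[h1 h2].
  have [h3 <-] : derivable F x 1 /\ derive1 F x = G x.
    by apply: FG; apply/andP; split; lra.
  by rewrite derive1E; apply/derivableP.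
- apply: continuous_in_subspaceT => x; rewrite inE /= in_itv /= => /andP[h1 h2].
  by apply: cF; apply/andP; split; lra.
rewrite in_itv /= => /andP[h1 h2] ->.
have -> : k.+1%:R / N%:R - k%:R / N%:R = N%:R^-1 :> R.
  by rewrite -mulrBl -natrB // subSnn mul1r.
rewrite (mulrC N%:R^-1) -mulrBl normrM [`|_^-1|]ger0_norm ?invr_ge0 //.
rewrite ler_wpM2r ?invr_ge0 //.
apply: le_trans (lipG _ _) _; rewrite ler_wpM2l //.
rewrite gtr0_norm ?subr_gt0 //.
have : (k.+1%:R : R) / N%:R = k%:R / N%:R + N%:R^-1.
  by rewrite -addn1 natrD mulrDl mul1r.
lra.
Unshelve. all: by end_near. Qed.

(** The recursion of [cube_integral] commutes with real and imaginary parts, so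
    estimates of integrals are only needed for real functions. *)
Fixpoint rcube n : ('rV[R]_n -> R) -> R :=
  match n with
  | 0 => fun f => f 0
  | n'.+1 => fun f => \int[mu]_(t in `[0, 1])
      rcube (fun y : 'rV[R]_n' => f (row_mx t%:M y))
  end.

Lemma cube_integralE n (f : 'rV[R]_n -> C) :
  cube_integral f = rcube (fun x => complex.Re (f x))
                 +i* rcube (fun x => complex.Im (f x)).
Proof.
elim: n f => [|n IH] f /=; first by case: (f 0).
rewrite /cintegral; congr (_ +i* _);
  by congr (Rintegral mu _ _); apply/funext => t; rewrite IH.
Qed.

(** Lipschitz continuity for the l1 distance, which splits coordinatewise. *)
Definition lip n (L : R) (f : 'rV[R]_n -> R) : Prop :=
  forall x y, `|f x - f y| <= L * \sum_i `|x 0 i - y 0 i|.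

Definition grid_pt n N (k : {ffun 'I_n -> 'I_N}) : 'rV[R]_n :=
  \row_i ((k i)%:R / N%:R).

Definition avg n N (f : 'rV[R]_n -> R) : R :=
  N%:R ^- n * \sum_(k : {ffun 'I_n -> 'I_N}) f (grid_pt k).

Lemma sum_ffunS (V : nmodType) n (T : finType) (F : {ffun 'I_n.+1 -> T} -> V) :
  \sum_k F k = \sum_(a : T) \sum_(k : {ffun 'I_n -> T})
    F [ffun i => if unlift ord0 i is Some j then k j else a].
Proof.
rewrite pair_big /=.
rewrite (reindex (fun p : T * {ffun 'I_n -> T} =>
  [ffun i => if unlift ord0 i is Some j then p.2 j else p.1])) //.
exists (fun k : {ffun 'I_n.+1 -> T} =>
  (k ord0, [ffun j : 'I_n => k (lift ord0 j)])) => [[a k] _|k _] /=.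
  rewrite ffunE unlift_none; congr (_, _); apply/ffunP => j.
  by rewrite !ffunE liftK.
apply/ffunP => i; rewrite ffunE; case: unliftP => [j|] -> //=.
by rewrite ffunE.
Qed.

Lemma sum_norm_row_mx n (s t : R) (y z : 'rV[R]_n) :
  \sum_(i < 1 + n) `|(row_mx s%:M y) 0 i - (row_mx t%:M z) 0 i|
  = `|s - t| + \sum_(i < n) `|y 0 i - z 0 i|.
Proof.
rewrite big_split_ord /= big_ord1 !row_mxEl !mxE eqxx !mulr1n; congr (_ + _).
by apply: eq_bigr => i _; rewrite !row_mxEr.
Qed.

Lemma grid_ptS n N (a : 'I_N) (k : {ffun 'I_n -> 'I_N}) :
  grid_pt [ffun i => if unlift ord0 i is Some j then k j else a]
  = row_mx (a%:R / N%:R)%:M (grid_pt k) :> 'rV[R]_(1 + n).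
Proof.
apply/rowP => i; rewrite !mxE ffunE; case: splitP => j e.
  have -> : i = ord0 by apply/val_inj; apply: etrans e _; rewrite ord1.
  by rewrite unlift_none ord1 !mxE eqxx mulr1n.
have -> : i = lift ord0 j by apply/val_inj; apply: etrans e _.
by rewrite liftK !mxE.
Qed.

Lemma avgS n N (f : 'rV[R]_(1 + n) -> R) :
  avg N f = N%:R^-1 * \sum_(a < N)
    avg N (fun y => f (row_mx (a%:R / N%:R)%:M y)).
Proof.
rewrite /avg sum_ffunS exprS invfM -mulrA; congr (_ * _).
rewrite -mulr_sumr; congr (_ * _); apply: eq_bigr => a _.
by apply: eq_bigr => k _; rewrite grid_ptS.
Qed.

Lemma card_grid n N : #|{ffun 'I_n -> 'I_N}| = (N ^ n)%N.
Proof. by rewrite card_ffun !card_ord. Qed.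

Lemma avg_dist_le n N (f g : 'rV[R]_n -> R) (e : R) : (0 < N)%N ->
  (forall x, `|f x - g x| <= e) -> `|avg N f - avg N g| <= e.
Proof.
move=> N0 fg; rewrite /avg -mulrBr -sumrB normrM.
have N0' : 0 < (N%:R ^+ n : R) by rewrite exprn_gt0 ?ltr0n.
rewrite gtr0_norm ?invr_gt0 // ler_pdivrMl //.
apply: le_trans (ler_norm_sum _ _ _) _.
apply: le_trans (ler_sum _ (fun k _ => fg _)) _.
by rewrite sumr_const card_grid -[leLHS]mulr_natl natrX.
Qed.

Lemma cvg_divn (c : R) : (fun n => c / n.+1%:R) @ \oo --> 0.
Proof.
rewrite -[X in _ --> X](mulr0 c); apply: cvgMr; exact: cvg_harmonic.
Qed.

(** In the induction on the dimension the estimate itself, as the mesh tends to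
    zero, shows that the inner integral is Lipschitz in the outer variable; the
    one-dimensional errors then add up. *)
Lemma rcube_avg_le n N (f : 'rV[R]_n -> R) (L : R) : (0 < N)%N -> lip L f ->
  `|rcube f - avg N f| <= n%:R * L / N%:R.
Proof.
elim: n N f => [|n IH] N f N0 lipf.
  rewrite mul0r mul0r normr_le0 subr_eq0 /= /avg expr0 invr1 mul1r.
  have c0 : f 0 = \sum_(k : {ffun 'I_0 -> 'I_N}) f (grid_pt k).
    have c1 : #|{ffun 'I_0 -> 'I_N}| = 1%N by rewrite card_grid expn0.
    rewrite (eq_bigr (fun=> f 0)) => [|k _]; first by rewrite sumr_const c1.
    by congr f; apply/rowP => -[].
  by rewrite c0.
have L0 : 0 <= L.
  have := le_trans (normr_ge0 _) (lipf (const_mx 1) 0).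
  rewrite (eq_bigr (fun=> 1)) => [|i _]; last by rewrite !mxE subr0 normr1.
  by rewrite sumr_const card_ord pmulr_lge0 // ltr0n.
pose h (t : R) (y : 'rV[R]_n) : R := f (row_mx t%:M y).
have liph t : lip L (h t).
  by move=> y z; apply: le_trans (lipf _ _) _; rewrite sum_norm_row_mx subrr normr0 add0r.
(* The averages of two slices differ by at most the sup distance. *)
have lipG s t : `|rcube (h s) - rcube (h t)| <= L * `|s - t|.
  have key M : `|rcube (h s) - rcube (h t)|
      <= L * `|s - t| + (2 * (n%:R * L)) / M.+1%:R.
    have h1 := IH M.+1 _ isT (liph s); have h2 := IH M.+1 _ isT (liph t).
    have h3 : `|avg M.+1 (h s) - avg M.+1 (h t)| <= L * `|s - t|.
      apply: avg_dist_le => // y; apply: le_trans (lipf _ _) _.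
      by rewrite sum_norm_row_mx big1 ?addr0 // => i _; rewrite subrr normr0.
    rewrite distrC in h2; rewrite -mulrA.
    have := ler_distD (avg M.+1 (h s)) (rcube (h s)) (rcube (h t)).
    have := ler_distD (avg M.+1 (h t)) (avg M.+1 (h s)) (rcube (h t)).
    move: h1 h2 h3; set e := _ / _; set q := L * _; lra.
  have lim : (fun M => L * `|s - t| + (2 * (n%:R * L)) / M.+1%:R) @ \oo
      --> L * `|s - t| + 0.
    by apply: cvgD; [apply: cvg_cst|apply: cvg_divn].
  rewrite addr0 in lim; apply: (cvgr_to_ge lim); near=> M; exact: key.
have r1 := riemann_sum1 N0 lipG.
have r2 : `|N%:R^-1 * \sum_(k < N) rcube (h (k%:R / N%:R)) - avg N f|
    <= n%:R * L / N%:R.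
  rewrite avgS -mulrBr -sumrB normrM ger0_norm ?invr_ge0 //.
  rewrite ler_pdivrMl ?ltr0n //; apply: le_trans (ler_norm_sum _ _ _) _.
  apply: (@le_trans _ _ (\sum_(k < N) (n%:R * L / N%:R))).
    by apply: ler_sum => k _; apply: IH.
  by rewrite sumr_const card_ord -[leLHS]mulr_natl.
have := ler_distD (N%:R^-1 * \sum_(k < N) rcube (h (k%:R / N%:R)))
  (rcube f) (avg N f).
move=> /le_trans; apply; apply: le_trans (lerD r1 r2) _.
by rewrite -mulrDl -[in leRHS]natr1 [in leRHS]mulrDl mul1r addrC.
Unshelve. all: by end_near. Qed.

End RiemannSums.

(** * Exponentials and the discrete Fourier transform *)

Section Exponentials.
Context {R : realType}.
Local Notation C := R[i].

Definition expi (t : R) : C := cos t +i* sin t.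

Lemma expi0 : expi 0 = 1.
Proof. by rewrite /expi cos0 sin0. Qed.

Lemma expiD s t : expi (s + t) = expi s * expi t.
Proof.
apply: complex_ext; first by rewrite cReM /= cosD.
by rewrite cImM /= sinD addrC.
Qed.

Lemma normc_expi t : normc (expi t) = 1.
Proof. by rewrite /= cos2Dsin2 sqrtr1. Qed.

Lemma expi_neq0 t : expi t != 0.
Proof.
apply/eqP => h; have := normc_expi t; rewrite h normc0 => /eqP.
by rewrite eq_sym oner_eq0.
Qed.

Lemma expi_sum (I : Type) (r : seq I) (F : I -> R) :
  expi (\sum_(i <- r) F i) = \prod_(i <- r) expi (F i).
Proof. by apply: (big_morph expi) => //; [exact: expiD|exact: expi0]. Qed.

Lemma expi_nat t n : expi (n%:R * t) = expi t ^+ n.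
Proof.
elim: n => [|n IH]; first by rewrite mul0r expi0 expr0.
by rewrite -natr1 mulrDl mul1r expiD IH exprSr.
Qed.

Lemma expi_2pi_int (z : int) : expi (2 * pi * z%:~R) = 1.
Proof.
have nat (n : nat) : expi (n%:R * (2 * pi)) = 1.
  rewrite expi_nat; have -> : expi (2 * pi) = 1.
    by rewrite mulr_natl /expi cos2pi sin2pi.
  by rewrite expr1n.
case: z => n; first by rewrite mulrC; exact: nat.
rewrite NegzE mulrNz; apply: (mulIf (expi_neq0 (2 * pi * n.+1%:R))).
by rewrite -expiD mulrN addNr expi0 mul1r mulrC nat.
Qed.

Lemma normc_expi_sub1 t : normc (expi t - 1) = 2 * `|sin (t / 2)|.
Proof.
apply: (@pexpIrn _ 2); rewrite ?nnegrE ?normc_ge0 ?mulr_ge0 //=.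
rewrite sqr_sqrtr ?addr_ge0 ?sqr_ge0 // exprMn real_normK ?num_real // sin2cos2.
have -> : cos t = cos (t / 2) ^+ 2 *+ 2 - 1.
  by rewrite -cos_mulr2n -[(t / 2) *+ 2]mulr_natr divfK.
have -> : sin t = (cos (t / 2) * sin (t / 2)) *+ 2.
  by rewrite -sin_mulr2n -[(t / 2) *+ 2]mulr_natr divfK.
rewrite oppr0 addr0 -mulrnAl exprMn sin2cos2; ring.
Qed.

(** Jordan's inequality with constant 1/2: halving the angle brings it below
    pi / 4, where the squared cosine is at least 1/2. *)
Lemma sin_ge_half (x : R) : 0 <= x <= pi / 2 -> x / 2 <= sin x.
Proof.
move=> /andP[x0 x1]; have [->|xn0] := eqVneq x 0; first by rewrite mul0r sin0.
have pi0 := pi_gt0 R.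
have xp : 0 < x by rewrite lt_neqAle eq_sym xn0.
pose y := x / 2.
have y0 : 0 < y by rewrite divr_gt0.
have cge t : 0 <= t <= y -> cos y <= cos t.
  move=> /andP[t0 ty]; rewrite leNgt ltr_cos ?in_itv /=.
  - by rewrite -leNgt.
  - by apply/andP; split; rewrite /y in y0 ty *; lra.
  - by apply/andP; split; rewrite /y in y0 ty *; lra.
have c2 : 2^-1 <= cos y ^+ 2.
  have : 0 <= cos x by apply: cos_ge0_pihalf; apply/andP; split; lra.
  have -> : x = y *+ 2 by rewrite mulr2n /y; lra.
  by rewrite cos_mulr2n mulr2n; lra.
have [|c] := @MVT R (@sin R) (@cos R) 0 y y0.
  by apply: continuous_subspaceT; exact: continuous_sin.
rewrite in_itv /= sin0 !subr0 => /andP[c0 cy] sy.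
have sy' : cos y * y <= sin y by rewrite sy ler_wpM2r ?(ltW y0) // cge // (ltW c0) (ltW cy).
rewrite (_ : sin x = 2 * (cos y * sin y)); last first.
  by rewrite mulr_natl -sin_mulr2n /y -[(x / 2) *+ 2]mulr_natr divfK.
have cy0 : 0 <= cos y by apply: cos_ge0_pihalf; rewrite /y; apply/andP; split; lra.
have h1 := ler_wpM2l cy0 sy'; rewrite mulrA -expr2 in h1.
have h2 := ler_wpM2r (ltW y0) c2.
have h3 : x / 2 = 2 * (2^-1 * y) by rewrite /y; field.
by rewrite h3; lra.
Qed.

Lemma normc_expi_sub1_ge t : `|t| <= pi -> `|t| / 2 <= normc (expi t - 1).
Proof.
move=> tpi; rewrite normc_expi_sub1.
have -> : `|sin (t / 2)| = sin (`|t| / 2).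
  have pos (s : R) : 0 <= s -> s <= pi -> `|sin (s / 2)| = sin (s / 2).
    by move=> s0 s1; rewrite ger0_norm // sin_ge0_pi //; have := pi_gt0 R;
      move=> p0; apply/andP; split; lra.
  move: tpi; case: (ger0P t) => t0 tpi; first by rewrite pos.
  by rewrite -{1}[t]opprK [in LHS]mulNr sinN normrN pos // oppr_ge0 ltW.
have := @sin_ge_half (`|t| / 2).
have h0 := normr_ge0 t; move: h0 tpi; set a := `|t| => h0 h1 h2.
have := h2 _; rewrite divr_ge0 //=; move=> h3.
have h4 : a / 2 <= pi / 2 by lra.
by have := h3 h4; lra.
Qed.

(** The modulus of the difference to 1 is [2 |sin (pi r / N)|], and [pi |r| / N] lies
    strictly between 0 and pi. *)
Lemma expi_root_neq1 (r : int) N : (0 < `|r|)%N -> (`|r| < N)%N ->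
  expi (2 * pi * (r%:~R / N%:R)) != 1.
Proof.
move=> r0 rN; rewrite -subr_eq0; apply/eqP => h.
have := normc_expi_sub1 (2 * pi * (r%:~R / N%:R)).
rewrite h normc0 => /esym/eqP; rewrite mulf_eq0 pnatr_eq0 /= normr_eq0.
have -> : 2 * pi * (r%:~R / N%:R) / 2 = pi * (r%:~R / N%:R) :> R.
  by set q := _ / N%:R; field.
have N0 : 0 < (N%:R : R) by rewrite ltr0n; apply: leq_ltn_trans rN.
have key (k : nat) : (0 < k)%N -> (k < N)%N -> sin (pi * (k%:R / N%:R : R)) != 0.
  move=> k0 kN; rewrite gt_eqF // sin_gt0_pi //.
  have q0 : 0 < (k%:R / N%:R : R) by rewrite divr_gt0 // ltr0n.
  by rewrite mulr_gt0 ?pi_gt0 //= gtr_pMr ?pi_gt0 // ltr_pdivrMr // mul1r ltr_nat.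
apply/negP; clear h; case: r r0 rN => q /= r0 rN; first exact: key.
by rewrite NegzE mulrNz mulNr mulrN sinN oppr_eq0; exact: key.
Qed.

(** Orthogonality of the characters of Z/N: a nontrivial root of unity has
    vanishing geometric sum. *)
Lemma sum_roots (r : int) N : (`|r| < N)%N ->
  \sum_(a < N) expi (2 * pi * (r%:~R * (a%:R / N%:R)))
  = if r == 0 then N%:R else 0.
Proof.
move=> rN; case: eqP => [->|/eqP r0].
  rewrite (eq_bigr (fun=> 1)) => [|a _]; last by rewrite mul0r mulr0 expi0.
  by rewrite sumr_const card_ord.
have N0 : (N%:R : R) != 0 by rewrite pnatr_eq0; case: N rN.
pose z := expi (2 * pi * (r%:~R / N%:R)).
rewrite (eq_bigr (fun a : 'I_N => z ^+ a)) => [|a _]; last first.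
  by rewrite -expi_nat; congr expi; ring.
have z1 : z - 1 != 0 by rewrite subr_eq0 expi_root_neq1 // absz_gt0.
apply: (mulfI z1); rewrite mulr0 -subrX1 -expi_nat.
rewrite (_ : _ * _ = 2 * pi * r%:~R); last by field.
by rewrite expi_2pi_int subrr.
Qed.

Section Grid.
Context {n : nat}.
Implicit Types (m : 'rV[int]_n) (x y : 'rV[R]_n).

Definition phase m x : R := 2 * pi * \sum_i (m 0 i)%:~R * x 0 i.

Lemma exE m x : ex m x = expi (phase m x).
Proof. by []. Qed.

Lemma phaseDr m x y : phase m (x + y) = phase m x + phase m y.
Proof.
rewrite /phase -mulrDr -big_split; congr (_ * _); apply: eq_bigr => i _.
by rewrite mxE mulrDr.
Qed.

Lemma phaseBr m x y : phase m (x - y) = phase m x - phase m y.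
Proof. by apply: (addIr (phase m y)); rewrite -phaseDr !subrK. Qed.

Lemma phaseDl m m' x : phase (m + m') x = phase m x + phase m' x.
Proof.
rewrite /phase -mulrDr -big_split; congr (_ * _); apply: eq_bigr => i _.
by rewrite mxE intrD mulrDl.
Qed.

Lemma phaseNl m x : phase (- m) x = - phase m x.
Proof.
rewrite /phase -mulrN -sumrN; congr (_ * _); apply: eq_bigr => i _.
by rewrite mxE mulrNz mulNr.
Qed.

Lemma exD m m' x : ex (m + m') x = ex m x * ex m' x.
Proof. by rewrite !exE phaseDl expiD. Qed.

Lemma exDr m x y : ex m (x + y) = ex m x * ex m y.
Proof. by rewrite !exE phaseDr expiD. Qed.

Lemma normc_ex m x : normc (ex m x) = 1.
Proof. exact: normc_expi. Qed.

Lemma ex_prod m x : ex m x = \prod_i expi (2 * pi * ((m 0 i)%:~R * x 0 i)).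
Proof. by rewrite exE -expi_sum /phase mulr_sumr. Qed.

Lemma ex_periodic m : Defs.periodic (@ex R n m).
Proof.
move=> k x; rewrite exDr [X in _ * X]exE /phase.
rewrite (_ : \sum_i _ = (\sum_i m 0 i * k 0 i)%:~R).
  by rewrite expi_2pi_int mulr1.
by rewrite rmorph_sum; apply: eq_bigr => i _ /=; rewrite mxE rmorphM.
Qed.

Definition cavg N (f : 'rV[R]_n -> C) : C :=
  N%:R ^- n * \sum_(k : {ffun 'I_n -> 'I_N}) f (grid_pt k).

Lemma cavgE N (f : 'rV[R]_n -> C) :
  cavg N f = avg N (fun x => complex.Re (f x))
          +i* avg N (fun x => complex.Im (f x)).
Proof.
rewrite /cavg /avg -cRe_sum -cIm_sum -real_complexE; congr (_ * _).
by rewrite fmorphV rmorphXn rmorph_nat.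
Qed.

(** Fourier coefficients of the restriction to the grid of mesh 1/N, that is of
    a function on (Z/N)^n. *)
Definition dft N (f : 'rV[R]_n -> C) m : C := cavg N (fun x => f x * ex (- m) x).

Lemma sum_ex_grid m N : (forall i, (`|m 0%R i| < N)%N) ->
  \sum_(k : {ffun 'I_n -> 'I_N}) (ex m (grid_pt k) : C)
  = if m == 0 then N%:R ^+ n else 0.
Proof.
move=> mN; under eq_bigr => k _ do rewrite ex_prod.
under eq_bigr => k _ do under eq_bigr => i _ do rewrite mxE.
rewrite -(bigA_distr_bigA (fun (i : 'I_n) (a : 'I_N) =>
  expi (2 * pi * ((m 0 i)%:~R * (a%:R / N%:R))))) /=.
under eq_bigr => i _ do rewrite sum_roots //.
case: eqP => [->|/eqP m0].
  rewrite (eq_bigr (fun=> N%:R)) => [|i _]; last by rewrite mxE eqxx.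
  by rewrite prodr_const card_ord.
have [i mi] : exists i, m 0 i != 0.
  apply/existsP; apply: contraNT m0 => /existsPn h.
  by apply/eqP/rowP => i; rewrite mxE; apply/eqP; have := h i; rewrite negbK.
by rewrite (bigD1 i) //= (negbTE mi) mul0r.
Qed.

Lemma cavg_ex m N : (forall i, (`|m 0%R i| < N)%N) -> (0 < N)%N ->
  cavg N (ex m) = (m == 0)%:R :> C.
Proof.
move=> mN N0; rewrite /cavg sum_ex_grid //; case: eqP => _ /=; last by rewrite mulr0.
by rewrite mulVf // expf_neq0 // pnatr_eq0 -lt0n.
Qed.

(** The frequencies in the box of radius N0 represent each residue class modulo
    2 N0 + 1 once, which gives the dual orthogonality relation. *)
Lemma sum_box_ex N0 (k k' : {ffun 'I_n -> 'I_(N0.*2.+1)}) :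
  \sum_(m <- box N0) (ex m (grid_pt k - grid_pt k') : C)
  = if k == k' then N0.*2.+1%:R ^+ n else 0.
Proof.
set N := N0.*2.+1.
rewrite big_box; under eq_bigr => b _ do rewrite ex_prod.
pose r i : int := (k i)%:Z - (k' i)%:Z.
have term (b : {ffun 'I_n -> 'I_N}) i :
    expi (2 * pi * ((box_pt b 0 i)%:~R * (grid_pt k - grid_pt k') 0 i))
    = expi (2 * pi * ((r i)%:~R * ((b i)%:R / N%:R)))
      * expi (- (2 * pi * ((r i)%:~R * (N0%:R / N%:R)))).
  rewrite -expiD; congr expi; rewrite !mxE /r !intrB /= -/N.
  by rewrite -!pmulrn; ring.
under eq_bigr => b _ do under eq_bigr => i _ do rewrite term.
rewrite -(bigA_distr_bigA (fun (i : 'I_n) (a : 'I_N) =>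
  expi (2 * pi * ((r i)%:~R * (a%:R / N%:R)))
      * expi (- (2 * pi * ((r i)%:~R * (N0%:R / N%:R)))))) /=.
have rN i : (`|r i| < N)%N.
  rewrite /r; have := ltn_ord (k i); have := ltn_ord (k' i); rewrite -/N.
  by move: (nat_of_ord (k i)) (nat_of_ord (k' i)) => a b; lia.
under eq_bigr => i _ do rewrite -mulr_suml sum_roots //.
case: eqP => [kk'|/eqP kk'].
  rewrite (eq_bigr (fun=> N%:R)) => [|i _].
    by rewrite prodr_const card_ord.
  by rewrite /r kk' subrr eqxx mul0r mulr0 oppr0 expi0 mulr1.
have [i ri] : exists i, k i != k' i.
  apply/existsP; apply: contraNT kk' => /existsPn h.
  by apply/eqP/ffunP => i; apply/eqP; have := h i; rewrite negbK.
rewrite (bigD1 i) //= ifF ?mul0r //; apply/negP; rewrite /r subr_eq0 => /eqP[e].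
by move/eqP: ri; apply; apply/val_inj.
Qed.

(** Fourier inversion on the grid is exact, and the frequencies that it needs
    are those of the box used in the definition of the series over Z^d. *)
Lemma dft_inversion N0 (f : 'rV[R]_n -> C) (k : {ffun 'I_n -> 'I_(N0.*2.+1)}) :
  \sum_(m <- box N0) dft N0.*2.+1 f m * ex m (grid_pt k) = f (grid_pt k).
Proof.
set N := N0.*2.+1.
have sw m : dft N f m * ex m (grid_pt k) =
    \sum_(k' : {ffun 'I_n -> 'I_N})
      N%:R ^- n * f (grid_pt k') * ex m (grid_pt k - grid_pt k').
  rewrite /dft /cavg -mulrA mulr_suml mulr_sumr; apply: eq_bigr => k' _.
  rewrite -!mulrA; congr (_ * (_ * _)); rewrite !exE -expiD; congr expi.
  by rewrite phaseNl phaseBr addrC.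
under eq_bigr => m _ do rewrite sw.
rewrite exchange_big /= (bigD1 k) //= [X in _ + X]big1 ?addr0 => [|k' kk'].
  rewrite -mulr_sumr sum_box_ex eqxx mulrAC mulVf ?mul1r //.
  by rewrite expf_neq0 // pnatr_eq0.
by rewrite -mulr_sumr sum_box_ex eq_sym (negbTE kk') mulr0.
Qed.

Lemma cavgD N (f g : 'rV[R]_n -> C) :
  cavg N (fun x => f x + g x) = cavg N f + cavg N g.
Proof. by rewrite /cavg -mulrDr -big_split. Qed.

Lemma cavgZ N a (f : 'rV[R]_n -> C) : cavg N (fun x => a * f x) = a * cavg N f.
Proof. by rewrite /cavg mulrCA [in RHS]mulr_sumr. Qed.

Lemma cavg_le N (f : 'rV[R]_n -> C) (b : R) : (0 < N)%N ->
  (forall x, normc (f x) <= b) -> normc (cavg N f) <= b.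
Proof.
move=> N0 fb; rewrite /cavg normcM normcV normcX normc_nat.
rewrite ler_pdivrMl ?exprn_gt0 ?ltr0n //; apply: le_trans (ler_normc_sum _ _ _) _.
apply: le_trans (ler_sum _ (fun k _ => fb _)) _.
by rewrite sumr_const card_grid -[leLHS]mulr_natl natrX.
Qed.

Lemma dft_le N (f : 'rV[R]_n -> C) m (b : R) : (0 < N)%N ->
  (forall x, normc (f x) <= b) -> normc (dft N f m) <= b.
Proof.
by move=> N0 fb; apply: cavg_le => // x; rewrite normcM normc_ex mulr1.
Qed.

Definition step_vec N (j : 'I_n) : 'rV[R]_n := (N%:R^-1 : R) *: delta_mx 0 j.

(** A translation by one mesh permutes the grid points, up to integer periods. *)
Lemma cavg_shift N (f : 'rV[R]_n -> C) (j : 'I_n) : (0 < N)%N -> Defs.periodic f ->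
  cavg N (fun x => f (x + step_vec N j)) = cavg N f.
Proof.
move=> N0 pf; rewrite /cavg; congr (_ * _).
pose up (k : {ffun 'I_n -> 'I_N}) : {ffun 'I_n -> 'I_N} :=
  [ffun i => if i == j then ordS (k i) else k i].
have up_inj : injective up.
  move=> k k' /ffunP h; apply/ffunP => i; have := h i; rewrite !ffunE.
  by case: eqP => // _; apply: ordS_inj.
rewrite [RHS](reindex_inj up_inj) /=; apply: eq_bigr => k _.
(* Only the last point in direction j leaves the grid. *)
pose c : 'rV[int]_n := \row_i (if (i == j) && ((k i).+1 == N) then -1 else 0).
rewrite -(pf c); congr f; apply/rowP => i; rewrite !mxE ffunE /=.
have Nn0 : (N%:R : R) != 0 by rewrite pnatr_eq0 -lt0n.
case: (eqVneq i j) => [->|_] /=; last by rewrite mulr0 !addr0.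
rewrite mulr1; case: (eqVneq (k j).+1 N) => [e|ne] /=.
  have eN : (N%:R : R) = (k j)%:R + 1 by rewrite -[in LHS]e -natr1.
  rewrite e modnn mul0r -[X in _ + X + _]mul1r -mulrDl -eN divff //.
  by rewrite subrr.
rewrite modn_small; last by rewrite ltn_neqAle; apply/andP; split; [exact: ne|exact: ltn_ord].
by rewrite addr0 -natr1 mulrDl mul1r.
Qed.

(** A difference of mesh 1/N multiplies the discrete coefficients by a factor that
    vanishes only when N divides the frequency. *)
Lemma dft_shift N (f : 'rV[R]_n -> C) m (j : 'I_n) : (0 < N)%N -> Defs.periodic f ->
  dft N (fun x => f (x + step_vec N j) - f x) m
  = (expi (2 * pi * ((m 0 j)%:~R / N%:R)) - 1) * dft N f m.
Proof.
move=> N0 pf; set w := expi _.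
have pfe : Defs.periodic (fun x => f x * ex (- m) x).
  by move=> k x; rewrite pf ex_periodic.
have exs : ex (- m) (step_vec N j) * w = 1.
  rewrite exE /w -expiD /phase (bigD1 j) //= big1 => [|i /negbTE ij]; last first.
    by rewrite !mxE ij andbF mulr0 mulr0.
  rewrite !mxE !eqxx mulr1 addr0 mulrNz -expi0; congr expi; ring.
rewrite mulrBl mul1r {2}/dft -(cavg_shift j N0 pfe) /dft -cavgZ.
rewrite -[X in _ - X]mul1r -mulNr -cavgZ -cavgD; congr cavg.
apply/funext => x; rewrite exDr mulrBl mulN1r; congr (_ - _).
rewrite -[LHS]mulr1 -exs; ring.
Qed.

End Grid.
End Exponentials.

(** * Derivatives, differences and bounds of real functions *)

Section RealSmooth.
Context {R : realType} {n : nat}.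
Implicit Types (f g : 'rV[R]_n -> R) (x y v : 'rV[R]_n).

(** Reduces directional derivatives to derivatives in one real variable, where the
    mean value theorem is available. *)
Lemma is_derive_line f x v (t : R) : derivable f (x + t *: v) v ->
  is_derive t (1 : R) (fun s : R => f (x + s *: v)) ('D_v f (x + t *: v)).
Proof.
have E : (fun h : R => h^-1 *: (f (x + (h *: (1 : R) + t) *: v) - f (x + t *: v)))
    = (fun h : R => h^-1 *: (f (h *: v + (x + t *: v)) - f (x + t *: v))).
  apply/funext => h; congr (_ *: (f _ - _)).
  by rewrite -[h *: 1]/(h * 1) mulr1 scalerDl addrCA.
by move=> df; split; rewrite ?/derivable ?/derive E.
Qed.

Lemma Rpartials_cat l l' f : Rpartials (l ++ l') f = Rpartials l (Rpartials l' f).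
Proof. by rewrite /Rpartials foldr_cat. Qed.

Lemma Rsmooth_partials l f : Rsmooth f -> Rsmooth (Rpartials l f).
Proof. by move=> sf l'; rewrite -Rpartials_cat; exact: sf. Qed.

Lemma Rsmooth_derivable f i x : Rsmooth f -> derivable f x (delta_mx 0 i).
Proof. by move=> sf; apply: (sf [::]).2. Qed.

Lemma Rsmooth_continuous f : Rsmooth f -> continuous f.
Proof. by move=> sf; apply: (sf [::]).1. Qed.

Lemma Rpartials_lin (a b : R) f g : Rsmooth f -> Rsmooth g -> forall l,
  Rpartials l (fun x => a * f x + b * g x)
  = (fun x => a * Rpartials l f x + b * Rpartials l g x).
Proof.
move=> sf sg; elim=> //= i l ->; apply/funext => x.
have df : derivable (Rpartials l f) x (delta_mx 0 i) by apply: (sf l).2.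
have dg : derivable (Rpartials l g) x (delta_mx 0 i) by apply: (sg l).2.
have daf : derivable (a *: Rpartials l f) x (delta_mx 0 i) by apply: derivableZ.
have dbg : derivable (b *: Rpartials l g) x (delta_mx 0 i) by apply: derivableZ.
have := deriveD daf dbg; rewrite (deriveZ _ df) (deriveZ _ dg).
by rewrite /Rpartial => <-.
Qed.

Lemma Rsmooth_lin (a b : R) f g : Rsmooth f -> Rsmooth g ->
  Rsmooth (fun x => a * f x + b * g x).
Proof.
move=> sf sg l; rewrite Rpartials_lin //; split=> [x|i x].
  have hf := @cvgMr R _ _ (nbhs_filter x) _ a _ ((sf l).1 x).
  have hg := @cvgMr R _ _ (nbhs_filter x) _ b _ ((sg l).1 x).
  exact: (@cvgD _ _ _ _ (nbhs_filter x) _ _ _ _ hf hg).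
apply: (@derivableD _ _ _ (a *: Rpartials l f) (b *: Rpartials l g)).
  by apply: derivableZ; apply: (sf l).2.
by apply: derivableZ; apply: (sg l).2.
Qed.

Lemma quotient_translate f h v x :
  (fun t : R => t^-1 *: (((fun y => f (y + h)) \o shift x) (t *: v) - f (x + h)))
  = (fun t : R => t^-1 *: ((f \o shift (x + h)) (t *: v) - f (x + h))).
Proof. by apply/funext => t; rewrite /= addrA. Qed.

Lemma derive_translate f h v x : 'D_v (fun y => f (y + h)) x = 'D_v f (x + h).
Proof. by rewrite /derive quotient_translate. Qed.

Lemma derivable_translate f h v x :
  derivable f (x + h) v -> derivable (fun y => f (y + h)) x v.
Proof. by rewrite /derivable quotient_translate. Qed.

Lemma Rpartials_translate f h l :
  Rpartials l (fun x => f (x + h)) = (fun x => Rpartials l f (x + h)).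
Proof.
elim: l => //= i l ->; apply/funext => x; exact: derive_translate.
Qed.

Lemma Rsmooth_translate f h : Rsmooth f -> Rsmooth (fun x => f (x + h)).
Proof.
move=> sf l; rewrite Rpartials_translate; split=> [x|i x].
  apply: (@continuous_comp _ _ _ (fun y => y + h) (Rpartials l f)).
    exact: (@cvgD _ _ _ _ (nbhs_filter x) _ _ _ _ cvg_id (cvg_cst h)).
  exact: (sf l).1.
by apply: derivable_translate; apply: (sf l).2.
Qed.

Lemma partial_bound_step f (B s : R) i x : Rsmooth f ->
  (forall y, `|Rpartial i f y| <= B) ->
  `|f (x + s *: delta_mx 0 i) - f x| <= B * `|s|.
Proof.
move=> sf fB; pose g (t : R) := f (x + t *: delta_mx 0 i).
have dg t : is_derive t (1 : R) g (Rpartial i f (x + t *: delta_mx 0 i)).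
  by apply: is_derive_line; exact: Rsmooth_derivable.
have cg : continuous g.
  move=> t; apply: differentiable_continuous; rewrite -derivable1_diffP.
  by have [] := dg t.
rewrite (_ : f x = g 0); last by rewrite /g scale0r addr0.
have gen (a b : R) : a <= b -> `|g b - g a| <= B * (b - a).
  move=> ab; have [c _ ->] := MVT_segment ab (fun t _ => dg t)
    (continuous_subspaceT cg).
  by rewrite normrM [`|b - a|]ger0_norm ?subr_ge0 // ler_wpM2r ?subr_ge0.
case: (ger0P s) => s0; first by have := gen 0 s s0; rewrite subr0.
by have := gen s 0 (ltW s0); rewrite sub0r distrC.
Qed.

(** Moving one coordinate at a time. *)
Lemma partial_bound_lip f (B : R) : Rsmooth f ->
  (forall i y, `|Rpartial i f y| <= B) -> lip B f.
Proof.
move=> sf fB x y.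
pose z k : 'rV[R]_n := \row_i (if (i < k)%N then x 0 i else y 0 i).
have z0 : z 0%N = y by apply/rowP => i; rewrite mxE.
have zn : z n = x by apply/rowP => i; rewrite mxE ltn_ord.
have step (i : 'I_n) : z i.+1 = z i + (x 0 i - y 0 i) *: delta_mx 0 i.
  apply/rowP => j; rewrite !mxE eqxx /= ltnS.
  case: (eqVneq j i) => [->|ji]; first by rewrite leqnn ltnn mulr1 addrC subrK.
  by rewrite leq_eqVlt (inj_eq val_inj) (negbTE ji) mulr0 addr0.
have -> : f x - f y = \sum_(i < n) (f (z i.+1) - f (z i)).
  rewrite -(big_mkord xpredT (fun k => f (z k.+1) - f (z k))).
  by rewrite (telescope_sumr (fun k => f (z k))) // z0 zn.
rewrite mulr_sumr; apply: le_trans (ler_norm_sum _ _ _) _.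
by apply: ler_sum => i _; rewrite step partial_bound_step.
Qed.

Lemma continuous_box_bounded f (lo hi : 'I_n -> R) : continuous f ->
  exists B, forall x, (forall i, lo i <= x 0 i <= hi i) -> `|f x| <= B.
Proof.
move=> cf; pose A := [set x : 'rV[R]_n | forall i, `[lo i, hi i]%classic (x ord0 i)].
have cA : compact A.
  apply: (@rV_compact R n (fun i => `[lo i, hi i]%classic)) => i.
  exact: segment_compact.
have [[a Aa]|A0] := pselect (A !=set0); last first.
  exists 0 => x hx; exfalso; apply: A0; exists x => i /=.
  by rewrite in_itv /= hx.
have cn : {within A, continuous (fun x => `|f x|)}.
  apply: continuous_subspaceT => x; apply: continuous_comp; first exact: cf.
  exact: norm_continuous.
have [c _ hc] := EVT_max_rV (ex_intro _ a Aa) cA cn.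
exists `|f c| => x hx; apply: hc; rewrite inE => i /=.
by rewrite in_itv /= hx.
Qed.

Lemma reduce_to_cube x : exists k : 'rV[int]_n,
  forall i, 0 <= (x + ivec k) 0 i <= 1.
Proof.
exists (\row_i (- Num.floor (x 0 i))) => i; rewrite !mxE mulrNz subr_ge0.
rewrite ge_floor lerBlDr addrC [leRHS](_ : _ = (Num.floor (x 0 i) + 1)%:~R).
  by rewrite ltW // floorD1_gt.
by rewrite intrD.
Qed.

Definition fdiff N (j : 'I_n) f x : R := f (x + step_vec N j) - f x.

Lemma fdiff_lin N j f : fdiff N j f = (fun x => 1 * f (x + step_vec N j) + (-1) * f x).
Proof. by apply/funext => x; rewrite mul1r mulN1r. Qed.

Lemma Rsmooth_fdiff N j f : Rsmooth f -> Rsmooth (fdiff N j f).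
Proof.
by move=> sf; rewrite fdiff_lin; apply: Rsmooth_lin => //; apply: Rsmooth_translate.
Qed.

Lemma Rpartials_fdiff N j f l : Rsmooth f ->
  Rpartials l (fdiff N j f) = fdiff N j (Rpartials l f).
Proof.
move=> sf; rewrite fdiff_lin Rpartials_lin //; last exact: Rsmooth_translate.
by rewrite Rpartials_translate fdiff_lin.
Qed.

(** Differences commute with derivatives, so each difference can be traded for one
    derivative and a factor 1/N by the mean value theorem. *)
Lemma iter_fdiff_le N j k f (B : R) : Rsmooth f ->
  (forall x, `|Rpartials (nseq k j) f x| <= B) ->
  forall x, `|iter k (fdiff N j) f x| <= N%:R ^- k * B.
Proof.
elim: k f B => [|k IH] f B sf fB x; first by rewrite expr0 invr1 mul1r; apply: fB.
rewrite iterSr exprSr invfM -mulrA.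
apply: IH => [|y]; first exact: Rsmooth_fdiff.
rewrite Rpartials_fdiff // /fdiff /step_vec.
apply: le_trans (partial_bound_step _ _ (Rsmooth_partials _ sf) fB) _.
by rewrite ger0_norm ?invr_ge0 // mulrC.
Qed.

End RealSmooth.

(** * Test functions on the torus *)

Section TestFunctions.
Context {R : realType} {n : nat}.
Local Notation C := R[i].
Implicit Types (phi psi : 'rV[R]_n -> C) (m : 'rV[int]_n) (x : 'rV[R]_n).

Definition trig m (a b : R) x : R := a * cos (phase m x) + b * sin (phase m x).

Lemma phase_delta m (i : 'I_n) (t : R) :
  phase m (t *: delta_mx 0 i) = 2 * pi * (m 0 i)%:~R * t.
Proof.
rewrite /phase (bigD1 i) //= big1 => [|j /negbTE ji].
  by rewrite !mxE !eqxx mulr1 addr0 mulrA.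
by rewrite !mxE ji andbF !mulr0.
Qed.

Lemma is_derive_trig m (i : 'I_n) (a b : R) x :
  is_derive x (delta_mx 0 i) (trig m a b)
    (trig m (2 * pi * (m 0 i)%:~R * b) (- (2 * pi * (m 0 i)%:~R * a)) x).
Proof.
set c := 2 * pi * _; set p := phase m x.
have dl : is_derive (0 : R) (1 : R)
    (fun t => a * cos (p + c * t) + b * sin (p + c * t))
    (c * b * cos p - c * a * sin p).
  apply: is_derive_eq; rewrite !mulr0 addr0 -[_ *: _]/(_ * _) -[b *: _]/(_ * _).
  rewrite add0r -![_ *: _]/(_ * _) mulr1; ring.
have E : (fun h : R => h^-1 *: ((trig m a b \o shift x) (h *: delta_mx 0 i)
                               - trig m a b x))
    = (fun h : R => h^-1 *: (((fun t => a * cos (p + c * t) + b * sin (p + c * t))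
        \o shift (0 : R)) (h *: (1 : R))
        - (a * cos (p + c * 0) + b * sin (p + c * 0)))).
  apply/funext => h; rewrite /= /trig phaseDr phase_delta -/c -/p.
  by rewrite addr0 mulr0 addr0 -[h *: 1]/(h * 1) mulr1 [c * h + p]addrC.
have [d1 d2] := dl; split.
  by rewrite /derivable E.
by rewrite /derive E; apply: (etrans d2); rewrite /trig mulNr.
Qed.

Lemma Rpartial_trig m (i : 'I_n) (a b : R) :
  Rpartial i (trig m a b)
  = trig m (2 * pi * (m 0 i)%:~R * b) (- (2 * pi * (m 0 i)%:~R * a)).
Proof. by apply/funext => x; have [_ h] := is_derive_trig m i a b x; exact: h. Qed.

(** Linear combinations of the cosine and the sine of one phase are stable under
    differentiation, which makes exponentials smooth by induction. *)
Lemma Rpartials_trig m l (a b : R) :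
  exists a' b', Rpartials l (trig m a b) = trig m a' b'.
Proof.
elim: l => [|i l [a' [b' h]]] /=; first by exists a, b.
by rewrite h Rpartial_trig; do 2 eexists.
Qed.

Lemma continuous_trig m (a b : R) : continuous (trig m a b).
Proof.
have cs r : continuous (fun y : 'rV[R]_n => \sum_(i <- r) (m 0 i)%:~R * y 0 i).
  elim: r => [|i r IH] x.
    rewrite (_ : (fun=> _) = cst 0); first exact: cst_continuous.
    by apply/funext => y; rewrite big_nil.
  rewrite (_ : (fun=> _) = fun y : 'rV[R]_n =>
    (m 0 i)%:~R * y 0 i + \sum_(i <- r) (m 0 i)%:~R * y 0 i).
    have h := @cvgMr R _ _ (nbhs_filter x) _ (m 0 i)%:~R _
      (@coord_continuous R _ _ 0 i x).
    exact: (@cvgD _ _ _ _ (nbhs_filter x) _ _ _ _ h (IH x)).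
  by apply/funext => y; rewrite big_cons.
have cp : continuous (@phase R n m).
  by move=> x; exact: (@cvgMr R _ _ (nbhs_filter x) _ _ _ (cs _ x)).
move=> x.
have hc := @continuous_comp _ _ _ _ cos x (cp x) (@continuous_cos R _).
have hs := @continuous_comp _ _ _ _ sin x (cp x) (@continuous_sin R _).
have hf := @cvgMr R _ _ (nbhs_filter x) _ a _ hc.
have hg := @cvgMr R _ _ (nbhs_filter x) _ b _ hs.
exact: (@cvgD _ _ _ _ (nbhs_filter x) _ _ _ _ hf hg).
Qed.

Lemma Rsmooth_trig m (a b : R) : Rsmooth (trig m a b).
Proof.
move=> l; have [a' [b' ->]] := Rpartials_trig m l a b.
split; first exact: continuous_trig.
by move=> i x; have [] := is_derive_trig m i a' b' x.
Qed.

Lemma Re_ex m : (fun x => complex.Re (ex m x : C)) = trig m 1 0.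
Proof. by apply/funext => x; rewrite /trig mul1r mul0r addr0. Qed.

Lemma Im_ex m : (fun x => complex.Im (ex m x : C)) = trig m 0 1.
Proof. by apply/funext => x; rewrite /trig mul1r mul0r add0r. Qed.

Lemma smooth_ex m : smooth (@ex R n m).
Proof. by split; rewrite ?Re_ex ?Im_ex; exact: Rsmooth_trig. Qed.

Lemma test_ex m : test (@ex R n m).
Proof. by split; [exact: smooth_ex|exact: ex_periodic]. Qed.

(** The Fourier symbol 2 pi i m_i of the partial derivative. *)
Definition deriv_symbol m (i : 'I_n) : C := 2 * pi%:C * 'i * (m 0 i)%:~R.

Lemma deriv_symbolE m i : deriv_symbol m i = 0 +i* (2 * pi * (m 0 i)%:~R).
Proof.
have -> : deriv_symbol m i = (2 * pi * (m 0 i)%:~R)%:C * 'i.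
  by rewrite !rmorphM rmorph_nat rmorph_int /deriv_symbol; ring.
by rewrite real_complexE /= mulr0 mulr1.
Qed.

Lemma partials_lin (a : C) phi psi l x : smooth phi -> smooth psi ->
  partials l (fun y => a * phi y + psi y) x
  = a * partials l phi x + partials l psi x.
Proof.
move=> [s1 s2] [s3 s4]; apply: complex_ext.
  rewrite cReD cReM /partials /=.
  rewrite (_ : (fun y => complex.Re (a * phi y + psi y)) = (fun y =>
    1 * (complex.Re a * complex.Re (phi y)
         + (- complex.Im a) * complex.Im (phi y)) + 1 * complex.Re (psi y))).
    by rewrite !Rpartials_lin //; [ring|exact: Rsmooth_lin].
  by apply/funext => y; rewrite cReD cReM; ring.
rewrite cImD cImM /partials /=.
rewrite (_ : (fun y => complex.Im (a * phi y + psi y)) = (fun y =>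
  1 * (complex.Re a * complex.Im (phi y)
       + complex.Im a * complex.Re (phi y)) + 1 * complex.Im (psi y))).
  by rewrite !Rpartials_lin //; [ring|exact: Rsmooth_lin].
by apply/funext => y; rewrite cImD cImM; ring.
Qed.

Lemma smooth_lin (a : C) phi psi : smooth phi -> smooth psi ->
  smooth (fun x => a * phi x + psi x).
Proof.
move=> [s1 s2] [s3 s4]; split.
  rewrite (_ : (fun y => complex.Re (a * phi y + psi y)) = (fun y =>
    1 * (complex.Re a * complex.Re (phi y)
         + (- complex.Im a) * complex.Im (phi y)) + 1 * complex.Re (psi y))).
    by do 2?apply: Rsmooth_lin.
  by apply/funext => y; rewrite cReD cReM; ring.
rewrite (_ : (fun y => complex.Im (a * phi y + psi y)) = (fun y =>
  1 * (complex.Re a * complex.Im (phi y)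
       + complex.Im a * complex.Re (phi y)) + 1 * complex.Im (psi y))).
  by do 2?apply: Rsmooth_lin.
by apply/funext => y; rewrite cImD cImM; ring.
Qed.

Lemma test_lin (a : C) phi psi : test phi -> test psi ->
  test (fun x => a * phi x + psi x).
Proof.
move=> [s1 p1] [s2 p2]; split; first exact: smooth_lin.
by move=> k x; rewrite p1 p2.
Qed.

Lemma test0 : test ((fun=> 0) : 'rV[R]_n -> C).
Proof.
have -> : (fun=> 0) = (fun x => -1 * (ex 0 x : C) + ex 0 x) :> ('rV[R]_n -> C).
  by apply/funext => x; rewrite mulN1r addNr.
by apply: test_lin; apply: test_ex.
Qed.

Lemma testZ (a : C) phi : test phi -> test (fun x => a * phi x).
Proof.
move=> tp; rewrite (_ : (fun x => a * phi x) = (fun x => a * phi x + 0)).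
  by apply: test_lin => //; apply: test0.
by apply/funext => x; rewrite addr0.
Qed.

Lemma test_sum (I : Type) (r : seq I) (a : I -> C) (phi : I -> 'rV[R]_n -> C) :
  (forall i, test (phi i)) -> test (fun x => \sum_(i <- r) a i * phi i x).
Proof.
move=> tp; elim: r => [|i r IH].
  by under eq_fun do rewrite big_nil; exact: test0.
by under eq_fun do rewrite big_cons; apply: test_lin.
Qed.

Lemma partials0 l x : partials l ((fun=> 0) : 'rV[R]_n -> C) x = 0.
Proof.
have [s0 _] := test0.
have := partials_lin (-1) l x s0 s0.
under eq_fun do rewrite mulr0 addr0.
by rewrite mulN1r addNr.
Qed.

Lemma partialsZ (a : C) phi l x : smooth phi ->
  partials l (fun y => a * phi y) x = a * partials l phi x.
Proof.
move=> sp; have [s0 _] := test0.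
have := partials_lin a l x sp s0; rewrite partials0 addr0 => <-.
by under [in RHS]eq_fun do rewrite addr0.
Qed.

Lemma partials_sum (I : Type) (r : seq I) (a : I -> C)
    (phi : I -> 'rV[R]_n -> C) l x : (forall i, test (phi i)) ->
  partials l (fun y => \sum_(i <- r) a i * phi i y) x
  = \sum_(i <- r) a i * partials l (phi i) x.
Proof.
move=> tp; elim: r => [|i r IH].
  by under eq_fun do rewrite big_nil; rewrite big_nil partials0.
under eq_fun do rewrite big_cons; rewrite partials_lin; last 2 first.
- exact: (tp i).1.
- exact: (test_sum _ _ tp).1.
by rewrite IH big_cons.
Qed.

Lemma partials_nil phi : partials [::] phi = phi.
Proof. by apply/funext => x; rewrite /partials /=; case: (phi x). Qed.

Lemma partials_cons i l phi : partials (i :: l) phi = partial i (partials l phi).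
Proof. by []. Qed.

Lemma partials_cat l l' phi : partials (l ++ l') phi = partials l (partials l' phi).
Proof. by apply/funext => x; rewrite /partials /= !Rpartials_cat. Qed.

Lemma partial_ex m i : partial i (@ex R n m) = (fun x => deriv_symbol m i * ex m x).
Proof.
apply/funext => x; rewrite /partial /partials /= Re_ex Im_ex !Rpartial_trig.
rewrite deriv_symbolE; apply: complex_ext; rewrite ?cReM ?cImM /= /trig /phase; ring.
Qed.

Lemma partials_ex m l x :
  partials l (@ex R n m) x = (\prod_(i <- l) deriv_symbol m i) * ex m x.
Proof.
elim: l x => [|i l IH] x; first by rewrite big_nil mul1r.
rewrite partials_cons (_ : partials l _ = fun x => (\prod_(i <- l) deriv_symbol m i) * ex m x).
  rewrite [LHS](partialsZ _ [:: i]) ?partial_ex; last exact: smooth_ex.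
  by rewrite -/(partial i _) partial_ex big_cons; ring.
exact/funext.
Qed.

Lemma smooth_partials l phi : smooth phi -> smooth (partials l phi).
Proof. by move=> [s1 s2]; split; apply: Rsmooth_partials. Qed.

Lemma test_partials l phi : test phi -> test (partials l phi).
Proof.
move=> [[s1 s2] p]; split; first exact: smooth_partials.
move=> k x; rewrite /partials.
rewrite -[Rpartials l _ (x + _)](f_equal (fun f => f x)
  (Rpartials_translate (fun y => complex.Re (phi y)) (ivec k) l)).
rewrite -[X in _ +i* X = _](f_equal (fun f => f x)
  (Rpartials_translate (fun y => complex.Im (phi y)) (ivec k) l)).
congr (_ +i* _); congr (Rpartials l _ x); apply/funext => y; by rewrite p.
Qed.

Lemma continuous_periodic_bounded phi :
  continuous (fun x => complex.Re (phi x)) ->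
  continuous (fun x => complex.Im (phi x)) -> Defs.periodic phi ->
  exists B, forall x, normc (phi x) <= B.
Proof.
move=> c1 c2 p.
have [B1 h1] := continuous_box_bounded (fun=> 0) (fun=> 1) c1.
have [B2 h2] := continuous_box_bounded (fun=> 0) (fun=> 1) c2.
exists (B1 + B2) => x; have [k hk] := reduce_to_cube x.
by rewrite -(p k); apply: le_trans (normc_le_ReIm _) _; apply: lerD; auto.
Qed.

Lemma test_bounded phi : test phi -> exists B, forall x, normc (phi x) <= B.
Proof.
by move=> [[s1 s2] p]; apply: continuous_periodic_bounded => //;
  apply: Rsmooth_continuous.
Qed.

(** A continuous periodic function is bounded by compactness of the cube; the
    induction peels off the derivative that is taken first, which preserves test
    functions. *)
Lemma test_partials_bounded k phi : test phi ->
  exists2 B, 0 <= B & forall l, (size l <= k)%N ->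
    forall x, normc (partials l phi x) <= B.
Proof.
elim: k phi => [|k IH] phi tp.
  have [B hB] := test_bounded tp.
  exists `|B| => // -[] // _ x; rewrite partials_nil.
  exact: le_trans (hB x) (ler_norm _).
have [B B0 hB] := IH _ tp.
have /choice [F hF] : forall i : 'I_n, exists b : R, 0 <= b /\ forall l,
    (size l <= k)%N -> forall x, normc (partials l (partials [:: i] phi) x) <= b.
  by move=> i; have [b b0 hb] := IH _ (test_partials [:: i] tp); exists b.
have F0 : 0 <= \sum_i F i by apply: sumr_ge0 => i _; apply: (hF i).1.
exists (B + \sum_i F i) => [|l]; first by rewrite addr_ge0.
case/lastP: l => [_ x|l i].
  by apply: le_trans (hB [::] isT x) _; rewrite lerDl.
rewrite size_rcons ltnS => lk x; rewrite -cats1 partials_cat.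
apply: le_trans ((hF i).2 l lk x) _.
rewrite (bigD1 i) //= addrCA lerDl addr_ge0 //.
by apply: sumr_ge0 => j _; apply: (hF j).1.
Qed.

Definition complex_lip (L : R) phi : Prop :=
  lip L (fun x => complex.Re (phi x)) /\ lip L (fun x => complex.Im (phi x)).

Lemma test_lip phi : test phi -> exists L, complex_lip L phi.
Proof.
move=> tp; have [B _ hB] := test_partials_bounded 1 tp; have [[s1 s2] _] := tp.
exists B; split; apply: partial_bound_lip => // i y.
  by apply: le_trans (Re_le_normc _) (hB [:: i] isT y).
by apply: le_trans (Im_le_normc _) (hB [:: i] isT y).
Qed.

Lemma lip_lin f g (L L' a b : R) : @lip R n L f -> lip L' g ->
  lip (`|a| * L + `|b| * L') (fun x => a * f x + b * g x).
Proof.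
move=> hf hg x y.
have -> : a * f x + b * g x - (a * f y + b * g y)
  = a * (f x - f y) + b * (g x - g y) by ring.
apply: le_trans (ler_normD _ _) _; rewrite !normrM mulrDl -!mulrA.
by apply: lerD; rewrite ler_wpM2l.
Qed.

Lemma lipM f g (L L' A B : R) : (forall x, `|f x| <= A) -> (forall x, `|g x| <= B) ->
  @lip R n L f -> lip L' g -> lip (A * L' + B * L) (fun x => f x * g x).
Proof.
move=> fA gB hf hg x y.
have -> : f x * g x - f y * g y = f x * (g x - g y) + g y * (f x - f y) by ring.
apply: le_trans (ler_normD _ _) _; rewrite !normrM mulrDl -!mulrA.
by apply: lerD; apply: ler_pM.
Qed.

Lemma complex_lipM phi psi (L L' A B : R) :
  (forall x, normc (phi x) <= A) -> (forall x, normc (psi x) <= B) ->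
  complex_lip L phi -> complex_lip L' psi ->
  complex_lip (2 * (A * L' + B * L)) (fun x => phi x * psi x).
Proof.
move=> hA hB [f1 f2] [g1 g2].
have rA x := le_trans (Re_le_normc _) (hA x).
have iA x := le_trans (Im_le_normc _) (hA x).
have rB x := le_trans (Re_le_normc _) (hB x).
have iB x := le_trans (Im_le_normc _) (hB x).
split.
  rewrite (_ : (fun x => _) = fun x => 1 * (complex.Re (phi x) * complex.Re (psi x))
      + (-1) * (complex.Im (phi x) * complex.Im (psi x))).
    rewrite (_ : 2 * ?[K] = `|1| * ?K + `|-1| * ?K); last first.
      by rewrite normrN normr1; ring.
    exact: lip_lin (lipM rA rB f1 g1) (lipM iA iB f2 g2).
  by apply/funext => x; rewrite cReM; ring.
rewrite (_ : (fun x => _) = fun x => 1 * (complex.Re (phi x) * complex.Im (psi x))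
    + 1 * (complex.Im (phi x) * complex.Re (psi x))).
  rewrite (_ : 2 * ?[K] = `|1| * ?K + `|1| * ?K); last by rewrite normr1; ring.
  exact: lip_lin (lipM rA iB f1 g2) (lipM iA rB f2 g1).
by apply/funext => x; rewrite cImM; ring.
Qed.

Lemma cube_integral_cavg phi (L : R) : complex_lip L phi ->
  ccvg (fun k => cavg k.+1 phi) (cube_integral phi).
Proof.
move=> [l1 l2]; apply: (@ccvg_le _ _ _ (fun k => (2 * (n%:R * L)) / k.+1%:R)).
  exact: cvg_divn.
move=> k; apply: le_trans (normc_le_ReIm _) _.
rewrite cavgE cube_integralE cReD cImD cReN cImN /=.
have h1 := rcube_avg_le (ltn0Sn k) l1; have h2 := rcube_avg_le (ltn0Sn k) l2.
rewrite distrC in h1; rewrite distrC in h2.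
by apply: le_trans (lerD h1 h2) _; rewrite -mulrDl le_eqVlt; apply/orP; left;
  apply/eqP; congr (_ / _); ring.
Qed.

(** The integrand is Lipschitz, being a product of bounded Lipschitz functions,
    so the grid averages converge to its integral. *)
Lemma dft_cvg phi m : test phi -> ccvg (fun k => dft k.+1 phi m) (fourier phi m).
Proof.
move=> tp; have [A hA] := test_bounded tp; have [L hL] := test_lip tp.
have [L' hL'] := test_lip (test_ex (- m)).
apply: (@cube_integral_cavg _ (2 * (A * L' + 1 * L))).
by apply: complex_lipM => // x; rewrite normc_ex.
Qed.

End TestFunctions.

(** * Decay of Fourier coefficients and Fourier inversion *)

Section Decay.
Context {R : realType} {d : nat}.
Hypothesis d0 : (0 < d)%N.
Local Notation C := R[i].
Implicit Types (phi : 'rV[R]_d -> C) (m : 'rV[int]_d) (x : 'rV[R]_d).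

(** One plus the sup norm: powers increase with the exponent, and some coordinate
    attains the maximum, so that derivatives along it suffice to measure decay. *)
Definition qnorm m : R := (1 + \max_i `|m 0%R i|)%N%:R.

Lemma qnorm_ge1 m : 1 <= qnorm m.
Proof. by rewrite ler1n. Qed.

Lemma qnorm_gt0 m : 0 < qnorm m.
Proof. exact: lt_le_trans ltr01 (qnorm_ge1 m). Qed.

Lemma le_qnorm m i : (1 + absz (m 0%R i))%:R <= qnorm m.
Proof. by rewrite ler_nat leq_add2l; apply: leq_bigmax. Qed.

Lemma qnorm_attained m : exists j, qnorm m = (1 + absz (m 0%R j))%:R.
Proof.
have [|j hj] := @bigop.eq_bigmax _ (fun i => `|m 0%R i|)%N; first by rewrite card_ord.
by exists j; rewrite /qnorm hj.
Qed.

Lemma qnormN m : qnorm (- m) = qnorm m.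
Proof.
by rewrite /qnorm; congr ((1 + _)%N%:R); apply: eq_bigr => i _; rewrite mxE abszN.
Qed.

Lemma qnorm_weight m : 1 <= weight m * qnorm m ^+ d.*2.
Proof.
have -> : qnorm m ^+ d.*2 = \prod_(i < d) qnorm m ^+ 2.
  by rewrite prodr_const card_ord -exprM mul2n.
rewrite /weight -big_split /=.
apply: (big_ind (fun z => 1 <= z)) => [//|y z|i _].
  by move=> hy hz; rewrite -[leLHS]mulr1 ler_pM.
rewrite mulrC ler_pdivlMr ?exprn_gt0 ?ltr0n // mul1r.
by rewrite lerXn2r ?nnegrE ?(ltW (qnorm_gt0 m)) ?ler0n // le_qnorm.
Qed.

(** Decay of order 2 d in the sup norm is enough for the product weight, which has
    order 2 in each of the d coordinates. *)
Lemma dominatedP (c : C) m (K : R) :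
  qnorm m ^+ d.*2 * normc c <= K -> normc c <= K * weight m.
Proof.
move=> h; apply: (@le_trans _ _ (normc c * (weight m * qnorm m ^+ d.*2))).
  by rewrite ler_peMr ?normc_ge0 // qnorm_weight.
by rewrite mulrCA [leRHS]mulrC ler_wpM2l ?(ltW (weight_gt0 m)) // mulrC.
Qed.

Definition cdiff N (j : 'I_d) phi x : C := phi (x + step_vec N j) - phi x.

Lemma cdiff_periodic N j phi : Defs.periodic phi -> Defs.periodic (cdiff N j phi).
Proof. by move=> p k x; rewrite /cdiff -addrA (addrC (ivec k)) addrA !p. Qed.

Lemma iter_cdiffE N j k phi x : iter k (cdiff N j) phi x
  = iter k (fdiff N j) (fun y => complex.Re (phi y)) x
  +i* iter k (fdiff N j) (fun y => complex.Im (phi y)) x.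
Proof.
elim: k x => [|k IH] x /=; first by case: (phi x).
by rewrite {1}/cdiff !IH.
Qed.

Lemma dft_iter_cdiff N j k phi m : (0 < N)%N -> Defs.periodic phi ->
  dft N (iter k (cdiff N j) phi) m
  = (expi (2 * pi * ((m 0 j)%:~R / N%:R)) - 1) ^+ k * dft N phi m.
Proof.
move=> N0 p; elim: k => [|k IH]; first by rewrite expr0 mul1r.
rewrite iterS dft_shift //; last first.
  by elim: (k) => //= k' IH'; apply: cdiff_periodic.
by rewrite IH exprS mulrA.
Qed.

(** The [k]-th difference multiplies the coefficient by a factor whose modulus is at
    least [(|m_j| / N) ^ k] on the box, and is itself at most [2 B / N ^ k]: the
    powers of N cancel and the bound is uniform in the mesh. *)
Lemma dft_decay phi m j k (B : R) n : test phi ->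
  (forall x, normc (partials (nseq k j) phi x) <= B) -> m \in box n ->
  (absz (m 0%R j))%:R ^+ k * normc (dft n.*2.+1 phi m) <= 2 * B.
Proof.
move=> [[s1 s2] p] hB mn; set N := n.*2.+1.
have N0 : (0 < N)%N by [].
have Ngt0 : 0 < (N%:R : R) by rewrite ltr0n.
have h1 x : normc (iter k (cdiff N j) phi x) <= 2 * (N%:R ^- k * B).
  rewrite iter_cdiffE; apply: le_trans (normc_le_ReIm _) _ => /=.
  rewrite mulr_natl mulr2n; apply: lerD; apply: iter_fdiff_le => // y.
    exact: le_trans (Re_le_normc _) (hB y).
  exact: le_trans (Im_le_normc _) (hB y).
have h2 := dft_le m N0 h1; rewrite dft_iter_cdiff // normcM normcX in h2.
have h3 : ((absz (m 0%R j))%:R / N%:R) ^+ k <=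
    normc (expi (2 * pi * ((m 0 j)%:~R / N%:R)) - 1) ^+ k :> R.
  apply: lerXn2r; rewrite ?nnegrE ?normc_ge0 ?divr_ge0 //.
  have pi0 := pi_gt0 R; have pi2 := pi_ge2 R.
  have nt : `|2 * pi * ((m 0 j)%:~R / N%:R)| = 2 * pi * ((absz (m 0%R j))%:R / N%:R) :> R.
    rewrite normrM [`|2 * pi|]ger0_norm ?mulr_ge0 ?ltW // normrM.
    by rewrite [`|N%:R^-1|]ger0_norm ?invr_ge0 ?ltW // -intr_norm natr_absz.
  have r0 : 0 <= (absz (m 0%R j))%:R / N%:R :> R by rewrite divr_ge0.
  have le2 : (absz (m 0%R j))%:R / N%:R <= 1 / 2 :> R.
    rewrite ler_pdivrMr // mulrC mul1r ler_pdivlMr // -natrM ler_nat.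
    by have := mn; rewrite mem_box => /forallP /(_ j); rewrite /N; lia.
  have := @normc_expi_sub1_ge R (2 * pi * ((m 0 j)%:~R / N%:R)).
  rewrite nt; set r := _ / _ in r0 le2 *; move=> h.
  have hp : 2 * pi * r <= pi by nra.
  by apply: le_trans (h hp); nra.
have h4 : ((absz (m 0%R j))%:R / N%:R) ^+ k * normc (dft N phi m) <= 2 * (N%:R ^- k * B).
  by apply: le_trans h2; rewrite ler_wpM2r ?normc_ge0.
have Nk : 0 < N%:R ^+ k :> R by rewrite exprn_gt0.
move: h4; rewrite exprMn exprVn mulrAC ler_pdivrMr // => /le_trans; apply.
have -> // : 2 * (N%:R ^- k * B) * N%:R ^+ k = 2 * B.
by field; rewrite gt_eqF.
Qed.

Lemma dft_qnorm phi m k (B : R) n : test phi ->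
  (forall l, (size l <= k)%N -> forall x, normc (partials l phi x) <= B) ->
  m \in box n ->
  qnorm m ^+ k * normc (dft n.*2.+1 phi m) <= 2 ^+ k * (2 * B).
Proof.
move=> tp hB mn; have [j ->] := qnorm_attained m.
have hB0 x : normc (phi x) <= B by rewrite -[phi]partials_nil; apply: hB.
have B0 : 0 <= B := le_trans (normc_ge0 _) (hB0 0).
have [m0|m0] := eqVneq (absz (m 0%R j)) 0%N.
  rewrite m0 expr1n mul1r; apply: le_trans (dft_le m _ hB0) _ => //.
  have : 1 <= 2 ^+ k :> R by rewrite exprn_ege1 // ler1n.
  by set z := 2 ^+ k => z1; nra.
have h := dft_decay (j := j) (k := k) tp (hB _ _) mn.
have {}h : (absz (m 0%R j))%:R ^+ k * normc (dft n.*2.+1 phi m) <= 2 * B.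
  by apply: h; rewrite size_nseq.
apply: (@le_trans _ _ (2 ^+ k * ((absz (m 0%R j))%:R ^+ k * normc (dft n.*2.+1 phi m)))).
  rewrite mulrA ler_wpM2r ?normc_ge0 // -exprMn lerXn2r ?nnegrE ?mulr_ge0 //.
  by rewrite -natrM ler_nat; lia.
by rewrite ler_wpM2l // exprn_ge0.
Qed.

Lemma cvg_double : (fun n => n.*2) @ \oo --> \oo.
Proof.
move=> A [N _ h]; exists N => // n /= Nn; apply: h => /=.
by rewrite -addnn; apply: leq_trans Nn (leq_addr _ _).
Qed.

Lemma ccvg_double (u : nat -> C) l : ccvg u l -> ccvg (fun n => u n.*2) l.
Proof.
move=> [h1 h2]; split.
  exact: (@cvg_comp _ _ _ _ (fun n => complex.Re (u n)) _ _ _ cvg_double h1).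
exact: (@cvg_comp _ _ _ _ (fun n => complex.Im (u n)) _ _ _ cvg_double h2).
Qed.

Lemma dft_box_cvg phi m : test phi ->
  ccvg (fun n => dft n.*2.+1 phi m) (fourier phi m).
Proof. by move=> tp; apply: (ccvg_double (dft_cvg m tp)). Qed.

(** The decay estimates of the discrete coefficients pass to the limit. *)
Lemma fourier_qnorm phi m k (B : R) : test phi ->
  (forall l, (size l <= k)%N -> forall x, normc (partials l phi x) <= B) ->
  qnorm m ^+ k * normc (fourier phi m) <= 2 ^+ k * (2 * B).
Proof.
move=> tp hB; have q0 : 0 < qnorm m ^+ k by rewrite exprn_gt0 ?qnorm_gt0.
rewrite -ler_pdivlMl //; apply: (ccvg_normc_le (dft_box_cvg m tp)).
apply: filterS (mem_box_near m) => n mn.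
by rewrite ler_pdivlMl // dft_qnorm.
Qed.

Definition decay_const (B : R) : R := 2 ^+ d.*2 * (2 * B).

Lemma fourier_dominated phi m (B : R) : test phi ->
  (forall l, (size l <= d.*2)%N -> forall x, normc (partials l phi x) <= B) ->
  normc (fourier phi m) <= decay_const B * weight m.
Proof. by move=> tp hB; apply: dominatedP; apply: fourier_qnorm. Qed.

Lemma near_grid_pt1 (t : R) N : (0 < N)%N -> 0 <= t <= 1 ->
  exists a : 'I_N, `|a%:R / N%:R - t| <= N%:R^-1.
Proof.
move=> N0 /andP[t0 t1]; have Ngt0 : 0 < (N%:R : R) by rewrite ltr0n.
have [t1'|] := ltP t 1; last first.
  move=> t1'; have -> : t = 1 by apply/le_anti; rewrite t1.
  have lt : (N.-1 < N)%N by rewrite ltn_predL.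
  exists (Ordinal lt); rewrite /=.
  have e : (N%:R : R) = N.-1%:R + 1 by rewrite natr1 prednK.
  have -> : N.-1%:R / N%:R - 1 = - N%:R^-1 :> R.
    have -> : (N.-1%:R : R) = N%:R - 1 by rewrite e addrK.
    by field; rewrite gt_eqF.
  by rewrite normrN ger0_norm // invr_ge0 ltW.
have tN0 : 0 <= t * N%:R by rewrite mulr_ge0 // ltW.
have := truncn_itv tN0; set a := Num.truncn _ => /andP[h1 h2].
have lt : (a < N)%N.
  by rewrite -(ltr_nat R); apply: le_lt_trans h1 _; rewrite gtr_pMl.
exists (Ordinal lt) => /=.
rewrite -[leRHS]mul1r -[t](mulfK (lt0r_neq0 Ngt0)) -mulrBl normrM.
rewrite [`|_^-1|]ger0_norm ?invr_ge0 ?(ltW Ngt0) // ler_wpM2r ?invr_ge0 ?(ltW Ngt0) //.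
rewrite -natr1 in h2; rewrite ler_norml; apply/andP; split; lra.
Qed.

Lemma near_grid_pt x N : (0 < N)%N -> (forall i, 0 <= x 0 i <= 1) ->
  exists k : {ffun 'I_d -> 'I_N}, forall i, `|(grid_pt k) 0 i - x 0 i| <= N%:R^-1.
Proof.
move=> N0 hx.
have /choice [a ha] : forall i, exists a : 'I_N, `|a%:R / N%:R - x 0 i| <= N%:R^-1.
  by move=> i; apply: near_grid_pt1.
by exists [ffun i => a i] => i; rewrite mxE ffunE.
Qed.

Lemma test_cvg phi x (y : nat -> 'rV[R]_d) : test phi ->
  (forall n i, `|(y n) 0 i - x 0 i| <= n.*2.+1%:R^-1) ->
  ccvg (fun n => phi (y n)) (phi x).
Proof.
move=> tp hy; have [L [l1 l2]] := test_lip tp.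
have L0 : 0 <= L.
  have := le_trans (normr_ge0 _) (l1 (const_mx 1) 0).
  rewrite (eq_bigr (fun=> 1)) => [|i _]; last by rewrite !mxE subr0 normr1.
  by rewrite sumr_const card_ord pmulr_lge0 // ltr0n.
have e0 : (fun n => (2 * (L * d%:R)) / n.+1%:R) @ \oo --> (0 : R) by exact: cvg_divn.
apply: ccvg_le e0 _ => n; apply: le_trans (normc_le_ReIm _) _.
have hs : L * \sum_i `|(y n) 0 i - x 0 i| <= L * d%:R / n.+1%:R.
  rewrite -mulrA ler_wpM2l //.
  apply: (@le_trans _ _ (\sum_(i < d) n.+1%:R^-1)).
    apply: ler_sum => i _; apply: le_trans (hy n i) _.
    rewrite lef_pV2 ?posrE ?ltr0n // ler_nat ltnS.
    by rewrite -addnn leq_addr.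
  by rewrite sumr_const card_ord -[leLHS]mulr_natl.
rewrite cReD cImD cReN cImN mulr_natl mulr2n mulrDl.
by apply: lerD; [apply: le_trans (l1 _ _) hs|apply: le_trans (l2 _ _) hs].
Qed.

(** Fourier inversion. The exact inversion formula on the grid of mesh
    1/(2n+1) passes to the limit by Tannery's theorem, because the discrete
    coefficients decay uniformly in the mesh. *)
Lemma fourier_inversion phi x : test phi ->
  zsum (fun m => fourier phi m * ex m x) = phi x.
Proof.
move=> tp; wlog hx : x / forall i, 0 <= x 0 i <= 1.
  move=> h; have [k hk] := reduce_to_cube x.
  rewrite -(tp.2 k) -(h _ hk); apply: zsum_eq => m.
  by rewrite ex_periodic.
have [B B0 hB] := test_partials_bounded d.*2 tp.
have /choice [y hy] : forall n, exists y : 'rV[R]_d,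
    (exists k : {ffun 'I_d -> 'I_(n.*2.+1)}, y = grid_pt k) /\
    forall i, `|y 0 i - x 0 i| <= n.*2.+1%:R^-1.
  move=> n; have [k hk] := near_grid_pt (ltn0Sn n.*2) hx.
  by exists (grid_pt k); split; [exists k|].
have hyx n i := (hy n).2 i.
have h1 : ccvg (fun n => \sum_(m <- box n) dft n.*2.+1 phi m * ex m (y n))
    (zsum (fun m => fourier phi m * ex m x)).
  apply: (@tannery _ _ (fun n m => dft n.*2.+1 phi m * ex m (y n)) _
    (decay_const B)) => [n m mn|m].
    by rewrite normcM normc_ex mulr1; apply: dominatedP; apply: dft_qnorm.
  by apply: ccvgM; [exact: dft_box_cvg|apply: test_cvg => //; exact: test_ex].
apply: (ccvg_unique h1); rewrite (_ : (fun n => _) = fun n => phi (y n)).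
  exact: test_cvg.
by apply/funext => n; have [[k ->] _] := hy n; rewrite dft_inversion.
Qed.

(** The mean value theorem turns the difference quotient into a derivative at a
    point at distance at most 1/N. *)
Lemma fdiff_partial_le N (j : 'I_d) (f : 'rV[R]_d -> R) (B : R) x : (0 < N)%N ->
  Rsmooth f -> (forall y, `|Rpartials [:: j; j] f y| <= B) ->
  `|N%:R * fdiff N j f x - Rpartial j f x| <= B / N%:R.
Proof.
move=> N0 sf hB; pose g (t : R) := f (x + t *: delta_mx 0 j).
have Ngt0 : 0 < (N%:R : R) by rewrite ltr0n.
have dg t : is_derive t (1 : R) g (Rpartial j f (x + t *: delta_mx 0 j)).
  by apply: is_derive_line; exact: Rsmooth_derivable.
have cg : continuous g.
  move=> t; apply: differentiable_continuous; rewrite -derivable1_diffP.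
  by have [] := dg t.
have iN0 : 0 <= (N%:R^-1 : R) by rewrite invr_ge0 ltW.
have [c] := MVT_segment iN0 (fun t _ => dg t) (continuous_subspaceT cg).
rewrite in_itv /= subr0 => /andP[c0 c1] e.
have -> : N%:R * fdiff N j f x = Rpartial j f (x + c *: delta_mx 0 j).
  rewrite -[RHS]mulr1 -[in RHS](mulVf (lt0r_neq0 Ngt0)) mulrA -e mulrC.
  by rewrite /g scale0r addr0.
apply: le_trans (partial_bound_step _ _ (Rsmooth_partials [:: j] sf) hB) _.
have B0 : 0 <= B := le_trans (normr_ge0 _) (hB 0).
by rewrite ler_wpM2l // ger0_norm.
Qed.

Lemma dft_partial phi (j : 'I_d) m : test phi -> exists K, forall N, (0 < N)%N ->
  normc (N%:R * (expi (2 * pi * ((m 0 j)%:~R / N%:R)) - 1) * dft N phi m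
         - dft N (partial j phi) m) <= K / N%:R.
Proof.
move=> tp; have [B B0 hB] := test_partials_bounded 2 tp.
have [[s1 s2] p] := tp.
exists (2 * B) => N N0; rewrite -mulrA -dft_shift // /dft.
rewrite -cavgZ -mulN1r -cavgZ -cavgD; apply: cavg_le => // x.
rewrite mulN1r mulrA -mulrBl normcM normc_ex mulr1.
apply: le_trans (normc_le_ReIm _) _.
rewrite cReD cImD cReN cImN -(rmorph_nat (real_complex R)) real_complexE /=.
rewrite cReD cImD cReN cImN mulr_natl mulr2n mulrDl.
apply: lerD; apply: fdiff_partial_le => // y.
  exact: le_trans (Re_le_normc _) (hB [:: j; j] isT y).
exact: le_trans (Im_le_normc _) (hB [:: j; j] isT y).
Qed.

(** The coefficient of a derivative. The limit of the difference factor is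
    read off from the exponential itself, whose discrete coefficient is 1. *)
Lemma fourier_partial phi (j : 'I_d) m : test phi ->
  fourier (partial j phi) m = deriv_symbol m j * fourier phi m.
Proof.
move=> tp.
have lim (psi : 'rV[R]_d -> C) : test psi -> ccvg (fun k => k.+1%:R *
    (expi (2 * pi * ((m 0 j)%:~R / k.+1%:R)) - 1) * dft k.+1 psi m)
    (fourier (partial j psi) m).
  move=> tps; have [K hK] := dft_partial j m tps.
  rewrite -[fourier _ _]add0r.
  have h1 : ccvg (fun k => k.+1%:R * (expi (2 * pi * ((m 0 j)%:~R / k.+1%:R)) - 1)
      * dft k.+1 psi m - dft k.+1 (partial j psi) m) 0.
    apply: (ccvg_le (cvg_divn K)) => k; rewrite subr0; exact: hK.
  have := ccvgD h1 (dft_cvg m (test_partials [:: j] tps)).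
  by under eq_fun do rewrite subrK.
have dft1 k : dft k.+1 (ex m) m = 1 :> C.
  rewrite /dft (_ : (fun x => _) = ex (0 : 'rV[int]_d) :> ('rV[R]_d -> C)).
    by rewrite cavg_ex ?eqxx // => i; rewrite mxE.
  by apply/funext => x; rewrite -exD subrr.
have h1 := lim _ (test_ex m).
have e : fourier (partial j (ex m)) m = deriv_symbol m j :> C.
  apply: (ccvg_unique (dft_cvg m (test_partials [:: j] (test_ex m)))).
  rewrite -/(partial j _) partial_ex.
  have -> : (fun k => dft k.+1 (fun x => deriv_symbol m j * ex m x) m) = fun=> deriv_symbol m j :> C.
    apply/funext => k; rewrite /dft (_ : (fun x => _) =
      fun x => deriv_symbol m j * (ex m x * ex (- m) x)); last first.
      by apply/funext => x; rewrite mulrA.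
    by rewrite cavgZ -/(dft _ _ _) dft1 mulr1.
  exact: ccvg_cst.
rewrite e in h1.
have {}h1 : ccvg (fun k => k.+1%:R * (expi (2 * pi * ((m 0 j)%:~R / k.+1%:R)) - 1))
    (deriv_symbol m j : C).
  apply: ccvg_near h1; apply: nearW => k.
  by rewrite dft1 mulr1.
apply: (ccvg_unique (lim _ tp)); apply: ccvgM => //; exact: dft_cvg.
Qed.

Lemma fourier_partials phi l m : test phi ->
  fourier (partials l phi) m = (\prod_(i <- l) deriv_symbol m i) * fourier phi m.
Proof.
move=> tp; elim: l => [|i l IH]; first by rewrite big_nil mul1r partials_nil.
rewrite partials_cons fourier_partial; last exact: test_partials.
by rewrite IH big_cons mulrA.
Qed.

Definition fourier_sum phi n x : C := \sum_(m <- box n) fourier phi m * ex m x.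

(** Differentiation and partial summation commute, so the error is the tail of
    the Fourier series of a derivative, dominated uniformly in [x]. *)
Lemma fourier_sum_partials_le phi l n (B : R) : test phi ->
  (forall l', (size l' <= d.*2 + size l)%N ->
    forall x, normc (partials l' phi x) <= B) ->
  forall x, normc (partials l (fun y => -1 * fourier_sum phi n y + phi y) x)
    <= decay_const B * (@wlim R d - @wsum R d n).
Proof.
move=> tp hB x.
rewrite partials_lin; last 2 first.
- exact: (test_sum _ _ (@test_ex R d)).1.
- exact: tp.1.
rewrite mulN1r addrC -(fourier_inversion x (test_partials l tp)).
rewrite partials_sum; last exact: test_ex.
under eq_bigr do rewrite partials_ex mulrA (mulrC (fourier _ _))
  -fourier_partials //.
apply: (zsum_tail_le (c := fun m => fourier (partials l phi) m * ex m x)) => m.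
rewrite normcM normc_ex mulr1; apply: fourier_dominated => [|l' hl' y].
  exact: test_partials.
by rewrite -partials_cat; apply: hB; rewrite size_cat leq_add2r.
Qed.

End Decay.

(** * Fourier series of distributions *)

Section Distributions.
Context {R : realType} {d : nat}.
Hypothesis d0 : (0 < d)%N.
Local Notation C := R[i].
Local Notation functional := (('rV[R]_d -> C) -> C).
Implicit Types (phi psi : 'rV[R]_d -> C) (m : 'rV[int]_d) (x : 'rV[R]_d)
  (T : functional).

Lemma fourier_lin (a : C) phi psi m : test phi -> test psi ->
  fourier (fun x => a * phi x + psi x) m = a * fourier phi m + fourier psi m.
Proof.
move=> tp ts; apply: (ccvg_unique (dft_cvg m (test_lin a tp ts))).
have := ccvgD (ccvgZ a (dft_cvg m tp)) (dft_cvg m ts).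
apply: ccvg_near; apply: nearW => k; rewrite /dft -cavgZ -cavgD; congr cavg.
by apply/funext => x; rewrite mulrDl mulrA.
Qed.

Lemma fourier0 m : fourier ((fun=> 0) : 'rV[R]_d -> C) m = 0.
Proof.
have t0 := @test0 R d; have := fourier_lin (-1) m t0 t0.
by under [X in fourier X]eq_fun do rewrite mulr0 addr0; rewrite mulN1r addNr.
Qed.

Lemma fourierZ (a : C) phi m : test phi ->
  fourier (fun x => a * phi x) m = a * fourier phi m.
Proof.
move=> tp; have := fourier_lin a m tp (@test0 R d).
by rewrite fourier0 addr0; under [X in fourier X]eq_fun do rewrite addr0.
Qed.

Lemma fourier_ex m m' : fourier (ex m) m' = (m == m')%:R :> C.
Proof.
apply: (ccvg_unique (dft_cvg m' (test_ex m))).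
apply: ccvg_near (ccvg_cst _); near=> k.
have kN : (\max_i `|(m - m')%R 0%R i| <= k)%N.
  by near: k; exists (\max_i `|(m - m')%R 0%R i|)%N.
rewrite /dft (_ : (fun x => _) = ex (m - m')); last first.
  by apply/funext => x; rewrite -exD.
rewrite cavg_ex ?subr_eq0 // => i; rewrite ltnS; apply: leq_trans kN.
exact: (@leq_bigmax _ (fun i => `|(m - m')%R 0%R i|)%N).
Unshelve. all: by end_near. Qed.

Lemma fcoef_fseries (c : 'rV[int]_d -> C) m : fcoef (fseries c) m = c m.
Proof.
rewrite /fcoef /fseries (zsum_supp1 (m := m)) => [|m' mm'].
  by rewrite fourier_ex eqxx mulr1.
by rewrite fourier_ex eqr_opp eq_sym (negbTE mm') mulr0.
Qed.

Lemma big_box_opp (V : nmodType) (F : 'rV[int]_d -> V) n :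
  \sum_(m <- box n) F (- m) = \sum_(m <- box n) F m.
Proof.
rewrite -(big_map (fun m => - m) xpredT F); apply: perm_big.
apply: uniq_perm; first by rewrite map_inj_uniq ?box_uniq //; exact: oppr_inj.
  exact: box_uniq.
move=> m; rewrite -[m in LHS]opprK (mem_map oppr_inj) !mem_box.
by apply: eq_forallb => i; rewrite mxE abszN.
Qed.

Section OneDistribution.
Variable T : functional.
Hypothesis dT : Defs.distribution T.

Lemma dist_lin (a : C) phi psi : test phi -> test psi ->
  T (fun x => a * phi x + psi x) = a * T phi + T psi.
Proof. by case: dT => h _; exact: h. Qed.

Lemma dist0 : T (fun=> 0) = 0.
Proof.
have t0 := @test0 R d; have := dist_lin (-1) t0 t0.
by under [X in T X]eq_fun do rewrite mulr0 addr0; rewrite mulN1r addNr.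
Qed.

Lemma distZ (a : C) phi : test phi -> T (fun x => a * phi x) = a * T phi.
Proof.
move=> tp; have := dist_lin a tp (@test0 R d).
by rewrite dist0 addr0; under [X in T X]eq_fun do rewrite addr0.
Qed.

Lemma dist_sum (I : Type) (r : seq I) (a : I -> C) (phi : I -> 'rV[R]_d -> C) :
  (forall i, test (phi i)) ->
  T (fun x => \sum_(i <- r) a i * phi i x) = \sum_(i <- r) a i * T (phi i).
Proof.
move=> tp; elim: r => [|i r IH].
  by under [X in T X]eq_fun do rewrite big_nil; rewrite big_nil dist0.
under [X in T X]eq_fun do rewrite big_cons.
rewrite dist_lin //; last exact: test_sum.
by rewrite IH big_cons.
Qed.

Lemma dist_order : exists (K : R) (k : nat), 0 <= K /\ forall phi (B : R), test phi ->
  (forall l, (size l <= k)%N -> forall x, normc (partials l phi x) <= B) ->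
  normc (T phi) <= K * B.
Proof.
case: dT => _ [K [k h]]; exists `|K|, k; split=> // phi B tp hB.
have B0 : 0 <= B := le_trans (normc_ge0 _) (hB [::] isT 0).
have := h phi B tp; rewrite normc_leP => /(_ _)/le_trans; apply.
  by move=> l lk x; rewrite normc_leP; exact: hB.
by rewrite ler_wpM2r // ler_norm.
Qed.

Lemma normc_deriv_symbol m i : normc (deriv_symbol m i : C) = 2 * pi * (absz (m 0%R i))%:R.
Proof.
rewrite deriv_symbolE /= expr0n /= add0r sqrtr_sqr normrM ger0_norm; last first.
  by rewrite mulr_ge0 // pi_ge0.
by rewrite -intr_norm natr_absz.
Qed.

Lemma prod_deriv_symbol_le (l : seq 'I_d) m k : (size l <= k)%N ->
  normc (\prod_(i <- l) deriv_symbol m i : C) <= (2 * pi * @qnorm R d m) ^+ k.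
Proof.
have q1 := @qnorm_ge1 R d m; have p2 := pi_ge2 R.
have b1 : 1 <= 2 * pi * @qnorm R d m by nra.
move=> lk; apply: (@le_trans _ _ ((2 * pi * @qnorm R d m) ^+ size l)); last first.
  exact: ler_weXn2l.
elim: l {lk} => [|i l IH]; first by rewrite big_nil expr0 normc1.
rewrite big_cons normcM /= exprS; apply: ler_pM; rewrite ?normc_ge0 //.
rewrite normc_deriv_symbol ler_wpM2l //; first by rewrite mulr_ge0 // pi_ge0.
by apply: le_trans (@le_qnorm R d m i); rewrite ler_nat leq_addl.
Qed.

(** Up to a constant, the derivatives of order at most [k] of an exponential are
    bounded by the [k]-th power of [qnorm] of its frequency. *)
Lemma fcoef_growth : exists (K : R) (k : nat), 0 <= K /\
  forall m, normc (fcoef T m) <= K * @qnorm R d m ^+ k.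
Proof.
have [K [k [K0 h]]] := dist_order.
exists (K * (2 * pi) ^+ k), k; split.
  by rewrite mulr_ge0 // exprn_ge0 // mulr_ge0 // pi_ge0.
move=> m; rewrite -mulrA -exprMn -(@qnormN R d m); apply: h; first exact: test_ex.
move=> l lk x; rewrite partials_ex normcM normc_ex mulr1; exact: prod_deriv_symbol_le.
Qed.

(** The Fourier sums of [phi] converge to [phi] in the seminorms that control [T],
    and [T] of such a sum is a box sum of the series. *)
Lemma dist_fourier phi : test phi ->
  T phi = zsum (fun m => fcoef T m * fourier phi (- m)).
Proof.
move=> tp; rewrite zsumE; apply/esym/ccvg_clim.
have [K [k [K0 hK]]] := dist_order.
have [B B0 hB] := test_partials_bounded (d.*2 + k) tp.
have hw := @wtail_cvg R d (K * @decay_const R d B).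
apply: (ccvg_le hw) => n.
 have -> : bsum (fun m => fcoef T m * fourier phi (- m)) n = T (fourier_sum phi n).
  rewrite /fourier_sum dist_sum; last exact: test_ex.
  rewrite /bsum -big_box_opp; apply: eq_bigr => m _.
  by rewrite opprK /fcoef opprK mulrC.
have ts : test (fourier_sum phi n) by apply: test_sum => m; exact: test_ex.
rewrite normcB addrC -mulN1r -dist_lin // -mulrA.
apply: hK => [|l lk x]; first exact: test_lin.
apply: fourier_sum_partials_le => // l' hl'; apply: hB.
by apply: leq_trans hl' _; rewrite leq_add2l.
Qed.

End OneDistribution.

Definition series_const (K : R) (k : nat) (B : R) : R := K * (2 ^+ (k + d.*2) * (2 * B)).

(** The smoothness of [phi] is spent on two things: [k] derivatives absorb the growth
    of the coefficients, and 2 d more make the series summable. *)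
Lemma series_dominated (c : 'rV[int]_d -> C) (K : R) k phi (B : R) : 0 <= K ->
  (forall m, normc (c m) <= K * @qnorm R d m ^+ k) -> test phi ->
  (forall l, (size l <= k + d.*2)%N -> forall x, normc (partials l phi x) <= B) ->
  forall m, normc (c m * fourier phi (- m)) <= series_const K k B * weight m.
Proof.
move=> K0 hc tp hB m; apply: dominatedP; rewrite normcM.
have h := @fourier_qnorm R d d0 phi (- m) _ B tp hB; rewrite qnormN in h.
apply: (@le_trans _ _ (K * (@qnorm R d m ^+ (k + d.*2) * normc (fourier phi (- m))))).
  have A0 : 0 <= @qnorm R d m ^+ d.*2 by rewrite exprn_ge0 // ltW // qnorm_gt0.
  have := ler_wpM2l (mulr_ge0 A0 (normc_ge0 (fourier phi (- m)))) (hc m).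
  set A := _ ^+ d.*2; set F := normc (fourier _ _); move=> le1.
  rewrite exprD -/A [leRHS](_ : _ = A * F * (K * @qnorm R d m ^+ k)); last by ring.
  by apply: le_trans le1; rewrite le_eqVlt; apply/orP; left; apply/eqP; ring.
by rewrite /series_const ler_wpM2l.
Qed.

End Distributions.

(** * The stationary equation, frequency by frequency *)

Section Symbol.
Context {R : realType} {d : nat}.
Variable alpha : R.
Hypothesis d0 : (0 < d)%N.
Hypothesis alpha0 : 0 < alpha.
Local Notation C := R[i].
Local Notation functional := (('rV[R]_d -> C) -> C).
Implicit Types (m : 'rV[int]_d).
Local Notation lam := (fl_symbol alpha).

Lemma lam_ge0 m : 0 <= lam m.
Proof. exact: powR_ge0. Qed.

Lemma znorm_sqr m : znorm m ^+ 2 = \sum_i (m 0 i)%:~R ^+ 2 :> R.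
Proof.
rewrite /znorm /enorm sqr_sqrtr; last by apply: sumr_ge0 => i _; exact: sqr_ge0.
by apply: eq_bigr => i _; rewrite mxE.
Qed.

Lemma lamN m : lam (- m) = lam m.
Proof.
rewrite /fl_symbol; congr ((_ * _) `^ _); rewrite /znorm /enorm.
by congr Num.sqrt; apply: eq_bigr => i _; rewrite !mxE mulrNz sqrrN.
Qed.

Lemma lam_growth : exists (K : R) (p : nat), 0 <= K /\
  forall m, lam m <= K * @qnorm R d m ^+ p.
Proof.
pose p := Num.trunc (2 * alpha).
have ap : 2 * alpha <= p.+1%:R.
  by have /andP[_ /ltW] := truncn_itv (ltW (mulr_gt0 (ltr0n R 2) alpha0)).
exists ((2 * pi * d%:R) ^+ p.+1), p.+1; have p2 := pi_ge2 R.
split; first by rewrite exprn_ge0 // mulr_ge0 // mulr_ge0 // pi_ge0.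
move=> m; rewrite -exprMn; have q1 := @qnorm_ge1 R d m.
have d1 : 1 <= d%:R :> R by rewrite ler1n.
have zq : znorm m <= d%:R * @qnorm R d m.
  rewrite -[leRHS]ger0_norm ?mulr_ge0 ?(le_trans ler01 q1) // -sqrtr_sqr.
  rewrite /znorm /enorm ler_sqrt ?sqr_ge0 //.
  apply: (@le_trans _ _ (\sum_(i < d) @qnorm R d m ^+ 2)).
    apply: ler_sum => i _; rewrite mxE -real_normK ?num_real //.
    rewrite lerXn2r ?nnegrE ?(le_trans ler01 q1) // -intr_norm -natr_absz.
    by apply: le_trans (@le_qnorm R d m i); rewrite ler_nat leq_addl.
  rewrite sumr_const card_ord exprMn -[leLHS]mulr_natl.
  by rewrite ler_wpM2r ?sqr_ge0 // expr2 ler_peMr.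
have b1 : 1 <= 2 * pi * d%:R * @qnorm R d m.
  have h1 : 1 <= 2 * pi * d%:R :> R.
    apply: (@le_trans _ _ (2 * pi)); first by lra.
    by rewrite ler_peMr // mulr_ge0 // pi_ge0.
  by rewrite -[leLHS]mulr1 ler_pM.
apply: (@le_trans _ _ ((2 * pi * d%:R * @qnorm R d m) `^ (2 * alpha))).
  apply: ge0_ler_powR; rewrite ?nnegrE ?mulr_ge0 ?pi_ge0 ?(ltW alpha0) ?sqrtr_ge0 //.
  by rewrite -[leRHS]mulrA ler_wpM2l ?mulr_ge0 ?pi_ge0.
by rewrite -powR_mulrn ?(le_trans ler01 b1) // ler_powR.
Qed.

Lemma frac_laplacian_ex (a : C) m :
  frac_laplacian alpha (fun x => a * ex m x) = fun x => (lam m)%:C * (a * ex m x).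
Proof.
apply/funext => x; rewrite /frac_laplacian (zsum_supp1 (m := m)) => [|m' mm'].
  rewrite (fourierZ _ _ (test_ex m)) fourier_ex eqxx mulr1; ring.
by rewrite (fourierZ _ _ (test_ex m)) fourier_ex eq_sym (negbTE mm') !(mulr0, mul0r).
Qed.

Variables (u : 'I_d -> functional) (w : 'I_d -> 'I_d -> functional).
Hypothesis du : forall i, Defs.distribution (u i).
Hypothesis dw : forall i j, Defs.distribution (w i j).
Hypothesis div0 : divergence_free u.
Hypothesis weak : forall phi : 'I_d -> 'rV[R]_d -> C,
  (forall i, test (phi i)) ->
  (forall x, \sum_i partial i (phi i) x = 0) ->
  - (\sum_i \sum_j w i j (partial j (phi i)))
  + \sum_i u i (frac_laplacian alpha (phi i)) = 0.

(** The divergence of [u] tested against an exponential. *)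
Lemma fcoef_orthogonal m : \sum_i (m 0 i)%:~R * fcoef (u i) m = 0.
Proof.
have := div0 (test_ex (- m)).
under eq_bigr do rewrite partial_ex (distZ (du _) _ (test_ex _)).
rewrite (_ : \sum_i _ = - (2 * pi%:C * 'i) * \sum_i (m 0 i)%:~R * fcoef (u i) m).
  move/eqP; rewrite mulf_eq0 oppr_eq0 => /orP[|/eqP //].
  have pi0 := gt_eqF (pi_gt0 R).
  have i0 : ('i : C) != 0 by rewrite eq_complex /= oner_eq0 andbF.
  have piC0 : (pi%:C : C) != 0 by rewrite eq_complex /= pi0.
  by rewrite !mulf_eq0 pnatr_eq0 (negbTE i0) (negbTE piC0).
rewrite mulr_sumr; apply: eq_bigr => i _; rewrite /deriv_symbol mxE mulrNz /fcoef; ring.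
Qed.

(** The vector field with constant direction [a] and frequency [- m] is divergence
    free exactly when [a] is orthogonal to [m]; it is an admissible test field. *)
Lemma weak_coef (a : 'I_d -> C) m : \sum_i a i * (m 0 i)%:~R = 0 ->
  \sum_i a i * fcoef (divergence w i) m
  + (lam m)%:C * \sum_i a i * fcoef (u i) m = 0.
Proof.
move=> ha; pose phi i := fun x : 'rV[R]_d => a i * ex (- m) x.
have tphi i : test (phi i) by apply: testZ; exact: test_ex.
have pphi i j : partial j (phi i) = fun x => a i * partial j (ex (- m)) x.
  by apply/funext => x; apply: (partialsZ _ [:: j]); exact: smooth_ex.
have dphi x : \sum_i partial i (phi i) x = 0.
  under eq_bigr do rewrite pphi partial_ex.
  rewrite (_ : \sum_i _
    = - (2 * pi%:C * 'i) * ex (- m) x * \sum_i a i * (m 0 i)%:~R).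
    by rewrite ha mulr0.
  rewrite mulr_sumr; apply: eq_bigr => i _; rewrite /deriv_symbol mxE mulrNz; ring.
apply: etrans (weak tphi dphi); congr (_ + _).
  rewrite -sumrN; apply: eq_bigr => i _; rewrite /fcoef /divergence mulrN.
  congr (- _); rewrite mulr_sumr; apply: eq_bigr => j _.
  by rewrite pphi (distZ (dw i j)) //; exact: (test_partials [:: j] (test_ex _)).
rewrite mulr_sumr; apply: eq_bigr => i _.
rewrite frac_laplacian_ex lamN; rewrite (distZ (du i) _ (tphi i)).
by rewrite (distZ (du i) _ (test_ex _)).
Qed.

(** Testing against the columns of the Leray symbol shows that the projected
    nonlinearity is minus the dissipation, frequency by frequency. *)
Lemma leray_coef i m :
  fcoef (leray (divergence w) i) m = - (lam m)%:C * fcoef (u i) m.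
Proof.
rewrite /leray fcoef_fseries.
set c := fun k => fcoef (divergence w k) m.
pose z : C := (znorm m ^+ 2)%:C.
(* At m = 0 the quotient vanishes, and a is a basis vector. *)
pose a k : C := (k == i)%:R - (m 0 i)%:~R * (m 0 k)%:~R / z.
have lin (v : 'I_d -> C) :
    \sum_k a k * v k = v i - (m 0 i)%:~R * (\sum_k (m 0 k)%:~R * v k) / z.
  rewrite /a; under eq_bigr do rewrite mulrBl.
  rewrite sumrB (bigD1 i) //= eqxx mul1r big1 ?addr0 => [|k /negbTE ->]; last first.
    by rewrite mul0r.
  congr (_ - _); rewrite mulr_sumr mulr_suml; apply: eq_bigr => k _; ring.
have am : \sum_k a k * (m 0 k)%:~R = 0.
  rewrite lin; have [->|m0] := eqVneq m 0; first by rewrite !mxE mul0r mul0r subrr.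
  have -> : \sum_k (m 0 k)%:~R * (m 0 k)%:~R = z.
    rewrite /z znorm_sqr rmorph_sum; apply: eq_bigr => k _ /=.
    by rewrite rmorphXn /= rmorph_int expr2.
  rewrite mulfK ?subrr // /z rmorphXn expf_neq0 // eq_complex /= eqxx andbT.
  apply: contraNneq m0 => zn0; have := znorm_sqr m; rewrite zn0 expr0n /= => /esym.
  move/eqP; rewrite psumr_eq0 => [/allP h|k _]; last exact: sqr_ge0.
  apply/eqP/rowP => k; rewrite mxE; apply/eqP.
  by have := h k (mem_index_enum _); rewrite /= sqrf_eq0 intr_eq0.
have := weak_coef am; rewrite !lin fcoef_orthogonal mulr0 mul0r subr0.
move=> /eqP; rewrite addr_eq0 => /eqP h; rewrite -/z [RHS]mulNr.
exact: h.
Qed.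

End Symbol.

(** * Duhamel integrals *)

Section TimeIntegrals.
Context {R : realType}.
Local Notation C := R[i].
Local Notation mu := (@lebesgue_measure R).
Implicit Types (f : R -> R) (t : R).

Lemma integrable_bounded_itv f t (M : R) : measurable_fun `]0, t[ f ->
  (forall s, 0 < s < t -> `|f s| <= M) ->
  mu.-integrable `]0, t[ (EFin \o f).
Proof.
move=> mf fM; apply: measurable_bounded_integrable => //.
  rewrite [X in (X < _)%E](lebesgue_measure_itv `]0, t[) /=; case: ifP => _; last exact: ltry.
  by rewrite -EFinB ltry.
exists M; split; first exact: num_real.
by move=> y My s /=; rewrite in_itv /= => hs; apply: le_trans (fM s hs) (ltW My).
Qed.

Lemma integrable_continuous_itv f t : continuous f ->
  mu.-integrable `]0, t[ (EFin \o f).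
Proof.
move=> cf; apply: (@integrableS _ _ _ mu `[0, t]) => //.
  exact: subset_itv_oo_cc.
apply: continuous_compact_integrable; first exact: segment_compact.
exact: continuous_subspaceT.
Qed.

Lemma uniform_limit_integral (b : nat -> R -> R) f (e : nat -> R) t (M : R) :
  0 < t -> (forall n, continuous (b n)) -> e @ \oo --> 0 ->
  (forall s, 0 < s < t -> `|f s| <= M) ->
  (forall n s, 0 < s < t -> `|f s - b n s| <= e n) ->
  mu.-integrable `]0, t[ (EFin \o f) /\
  (fun n => \int[mu]_(s in `]0, t[) b n s) @ \oo --> \int[mu]_(s in `]0, t[) f s.
Proof.
move=> t0 cb e0 fM fb.
have bf s : 0 < s < t -> b ^~ s @ \oo --> f s.
  move=> hs; apply/subr_cvg0/norm_cvg0P; apply: (squeeze_cvgr _ (cvg_cst 0) e0).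
  by near=> n; rewrite normr_ge0 /= distrC; exact: fb.
have mf : measurable_fun `]0, t[ f.
  apply: (measurable_fun_cvg (h := b)) => [n|s].
    by apply: measurable_funTS; exact: continuous_measurable_fun.
  by rewrite /= in_itv /=; exact: bf.
have intf := integrable_bounded_itv mf fM; split=> //.
have intb n := integrable_continuous_itv t (cb n).
have et0 : (fun n => t * e n) @ \oo --> 0 by rewrite -(mulr0 t); apply: cvgMr.
apply/subr_cvg0/norm_cvg0P; apply: (squeeze_cvgr _ (cvg_cst 0) et0).
near=> n; rewrite normr_ge0 /= distrC -RintegralB //.
have intd : mu.-integrable `]0, t[ (EFin \o (fun s => f s - b n s)).
  have hd := @integrableB _ _ _ mu `]0, t[ (measurable_itv _) _ _ intf (intb n).
  exact: hd.
apply: le_trans (le_normr_Rintegral _ intd) _ => //.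
apply: (@le_trans _ _ (\int[mu]_(s in `]0, t[) e n)).
  apply: le_Rintegral => //.
  - by have hn := integrable_norm intd; exact: hn.
  - by apply: integrable_continuous_itv; exact: cst_continuous.
  - by move=> s; rewrite /= in_itv /=; exact: fb.
rewrite Rintegral_cst // [X in fine X](lebesgue_measure_itv `]0, t[) /= lte_fin t0.
by rewrite /= subr0 mulrC.
Unshelve. all: by end_near. Qed.

Lemma Rintegral_sum_itv (I : Type) (r : seq I) (a : I -> R) (k : I -> R -> R) t :
  (forall i, continuous (k i)) ->
  continuous (fun s => \sum_(i <- r) a i * k i s) /\
  \int[mu]_(s in `]0, t[) (\sum_(i <- r) a i * k i s)
  = \sum_(i <- r) a i * \int[mu]_(s in `]0, t[) k i s.
Proof.
move=> ck; elim: r => [|i r [IHc IH]].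
  have -> : (fun s => \sum_(i <- [::]) a i * k i s) = cst 0.
    by apply/funext => s; rewrite big_nil.
  split; first exact: cst_continuous.
  by rewrite big_nil Rintegral_cst // mul0r.
have cak : continuous (fun s => a i * k i s).
  by move=> s; apply: cvgMr; exact: ck.
have -> : (fun s => \sum_(i <- i :: r) a i * k i s)
    = (fun s => a i * k i s + \sum_(i <- r) a i * k i s).
  by apply/funext => s; rewrite big_cons.
split; first by move=> s; apply: cvgD; [exact: cak|exact: IHc].
rewrite RintegralD //; [|exact: integrable_continuous_itv..].
by rewrite RintegralZl // ?IH ?big_cons //; exact: integrable_continuous_itv.
Qed.

Lemma continuous_expR_affine (l t : R) :
  continuous (fun s => expR (- (t - s) * l)).
Proof.
move=> s; apply: (@continuous_comp _ _ _ (fun s => - (t - s) * l) expR).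
  apply: cvgMl; apply: cvgN; apply: cvgB; [exact: cvg_cst|exact: cvg_id].
exact: continuous_expR.
Qed.

Lemma integral_heat_kernel (l t : R) : 0 < t ->
  \int[mu]_(s in `]0, t[) (l * expR (- (t - s) * l)) = 1 - expR (- t * l).
Proof.
move=> t0.
have ck : continuous (fun s => l * expR (- (t - s) * l)).
  by move=> s; apply: cvgMr; exact: continuous_expR_affine.
pose F s := expR (- (t - s) * l).
have dF (s : R) : is_derive s (1 : R) F (l * expR (- (t - s) * l)).
  rewrite /F; apply: is_derive_eq.
  by rewrite -![_ *: _]/(_ * _); ring.
rewrite /Rintegral -(@integral_itv_bndoo _ _ _ _ true false); last first.
  by apply/measurable_EFinP; apply: measurable_funTS; exact: continuous_measurable_fun.
rewrite (@continuous_FTC2 _ _ F) //=.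
- by rewrite /F subrr oppr0 mul0r expR0 addr0.
- exact: continuous_subspaceT.
- have cF : continuous F by exact: continuous_expR_affine.
  split.
  + by move=> s _; have [] := dF s.
  + by apply: cvg_at_right_filter; exact: cF.
  + by apply: cvg_at_left_filter; exact: cF.
- by move=> s _; rewrite derive1E; have [_ h] := dF s; exact: h.
Qed.

Section Duhamel.
Context {d : nat}.
Implicit Types m : 'rV[int]_d.
Variables (l : 'rV[int]_d -> R) (h : 'rV[int]_d -> C) (K t : R).
Hypothesis t0 : 0 < t.
Hypothesis l0 : forall m, 0 <= l m.
Hypothesis hK : forall m, normc ((l m)%:C * h m) <= K * weight m.
Hypothesis hK' : forall m, normc (h m) <= K * weight m.

Let f s : C := zsum (fun m => (expR (- (t - s) * l m))%:C * (- (l m)%:C * h m)).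

Lemma expRNM_le1 (a b : R) : 0 <= a -> 0 <= b -> expR (- a * b) <= 1.
Proof. by move=> a0 b0; rewrite -expR0 ler_expR mulNr oppr_le0 mulr_ge0. Qed.

(** The heat factors are at most 1, so the box sums converge uniformly on the time
    interval and integration term by term is allowed. *)
Lemma duhamel_series : cintegrable `]0, t[ f /\
  cintegral `]0, t[ f = zsum (fun m => (expR (- t * l m) - 1)%:C * h m).
Proof.
pose g s m : C := (expR (- (t - s) * l m))%:C * (- (l m)%:C * h m).
have gK s : 0 < s < t -> forall m, normc (g s m) <= K * weight m.
  move=> /andP[s0 st] m; rewrite /g normcM normcR ger0_norm ?expR_ge0 //.
  rewrite [X in normc X]mulNr normcN; apply: le_trans (hK m).
  by rewrite ler_piMl ?normc_ge0 // expRNM_le1 // subr_ge0 ltW.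
pose q m : C := (expR (- t * l m) - 1)%:C * h m.
have qK m : normc (q m) <= K * weight m.
  rewrite /q normcM normcR; apply: le_trans (hK' m).
  rewrite ler_piMl ?normc_ge0 // ler_norml.
  have := expRNM_le1 (ltW t0) (l0 m); have := expR_ge0 (- t * l m).
  by move=> h1 h2; apply/andP; split; lra.
have gpart (p : C -> R) : (forall z w, p (z + w) = p z + p w) ->
    (forall z, p (- z) = - p z) -> (forall (r : R) z, p (r%:C * z) = r * p z) ->
    (forall I (s : seq I) (F : I -> C), p (\sum_(i <- s) F i) = \sum_(i <- s) p (F i)) ->
    (forall z, `|p z| <= normc z) ->
    mu.-integrable `]0, t[ (EFin \o (fun s => p (f s))) /\
    \int[mu]_(s in `]0, t[) p (f s) = p (zsum q).
  move=> pD pN pZ ps ple.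
  pose k m s := l m * expR (- (t - s) * l m).
  have ck m : continuous (k m).
    by move=> s; apply: cvgMr; exact: continuous_expR_affine.
  pose b n s := \sum_(m <- box n) - p (h m) * k m s.
  have bE n s : b n s = p (bsum (g s) n).
    rewrite /b /bsum ps; apply: eq_bigr => m _.
    by rewrite /g pZ [X in _ = _ * p X]mulNr pN pZ /k; ring.
  have cb n : continuous (b n).
    by have [] := Rintegral_sum_itv (box n) (fun m => - p (h m)) t ck.
  have := @uniform_limit_integral b (fun s => p (f s))
    (fun n => K * (@wlim R d - @wsum R d n)) t (K * @wlim R d) t0 cb.
  move=> [|s hs|n s hs|h1 h2]; first exact: wtail_cvg.
  - by apply: le_trans (ple _) _; apply: zsum_le; exact: gK.
  - rewrite bE -pN -pD; apply: le_trans (ple _) _.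
    by apply: zsum_tail_le; exact: gK.
  split=> //.
  have bint n : \int[mu]_(s in `]0, t[) b n s = p (bsum q n).
    have [_ ->] := Rintegral_sum_itv (box n) (fun m => - p (h m)) t ck.
    rewrite /bsum ps; apply: eq_bigr => m _.
    by rewrite integral_heat_kernel // /q pZ; ring.
  have h3 : (fun n => p (bsum q n)) @ \oo --> p (zsum q).
    apply/subr_cvg0/norm_cvg0P.
    apply: (squeeze_cvgr _ (cvg_cst 0) (@wtail_cvg R d K)).
    near=> n; rewrite normr_ge0 /= distrC -pN -pD; apply: le_trans (ple _) _.
    exact: zsum_tail_le.
  rewrite (_ : (fun n => p (bsum q n)) = fun n => \int[mu]_(s in `]0, t[) b n s) in h3.
    by rewrite -(cvg_lim _ h2) // (cvg_lim _ h3).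
  by apply/funext => n; rewrite bint.
have ReZ (r : R) z : complex.Re (r%:C * z) = r * complex.Re z.
  by rewrite real_complexE.
have ImZ (r : R) z : complex.Im (r%:C * z) = r * complex.Im z.
  by rewrite real_complexE.
have [i1 e1] := gpart (@complex.Re R) cReD cReN ReZ
  (fun I s F => cRe_sum s xpredT F) Re_le_normc.
have [i2 e2] := gpart (@complex.Im R) cImD cImN ImZ
  (fun I s F => cIm_sum s xpredT F) Im_le_normc.
by split=> //; rewrite /cintegral e1 e2; case: (zsum q).
Unshelve. all: by end_near. Qed.

End Duhamel.
End TimeIntegrals.

(** * Time slices of space-time test functions *)

Section Slices.
Context {R : realType} {d : nat}.
Local Notation C := R[i].
Implicit Types (Phi : 'rV[R]_(1 + d) -> C) (f : 'rV[R]_(1 + d) -> R)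
  (x : 'rV[R]_d) (t : R).

Lemma continuous_row_mxr t : continuous (fun x : 'rV[R]_d => row_mx t%:M x).
Proof.
move=> x A [P hP PA]; exists (fun i j => P i (rshift 1 j)).
  by move=> i j; have := hP i (rshift 1 j); rewrite row_mxEr.
move=> y hy; apply: PA => i j; case: (split_ordP j) => k ->.
  have := hP i (lshift d k); rewrite !row_mxEl => /nbhs_singleton.
  exact.
by rewrite row_mxEr; exact: hy.
Qed.

Lemma continuous_row_mxl x : continuous (fun t : R => row_mx (t%:M : 'M[R]_1) x).
Proof.
move=> t A [P hP PA].
have := hP 0 (lshift d 0); rewrite row_mxEl mxE eqxx mulr1n => h0.
apply: filterS h0 => s hs; apply: PA => i j; case: (split_ordP j) => k ->.
  by rewrite row_mxEl !ord1 mxE eqxx mulr1n.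
have := hP i (rshift 1 k); rewrite !row_mxEr => /nbhs_singleton.
exact.
Qed.

(** Difference quotients of a slice are difference quotients of the function itself
    in a spatial direction. *)
Lemma slice_quotient f t x (j : 'I_d) :
  (fun h : R => h^-1 *: (((fun y => f (row_mx t%:M y)) \o shift x)
     (h *: delta_mx 0 j) - f (row_mx t%:M x)))
  = (fun h : R => h^-1 *: ((f \o shift (row_mx t%:M x))
     (h *: delta_mx 0 (rshift 1 j)) - f (row_mx t%:M x))).
Proof.
apply/funext => h /=; congr (_ *: (f _ - _)).
apply/rowP => i; rewrite !mxE; case: splitP => k e; rewrite !mxE.
  have -> : (i == rshift 1 j) = false.
    by apply/negbTE; rewrite -val_eqE /= e; have := ltn_ord k; case: (nat_of_ord k).
  by rewrite andbF mulr0 add0r.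
congr (_ * _%:R + _); congr (_ && _).
by rewrite -!val_eqE /= e eqn_add2l.
Qed.

Lemma Rpartials_slice f t l :
  Rpartials l (fun x : 'rV[R]_d => f (row_mx t%:M x))
  = (fun x => Rpartials (map (@rshift 1 d) l) f (row_mx t%:M x)).
Proof.
elim: l => //= j l ->; apply/funext => x.
by rewrite /Rpartial /derive slice_quotient.
Qed.

Lemma Rsmooth_slice f t : Rsmooth f ->
  Rsmooth (fun x : 'rV[R]_d => f (row_mx t%:M x)).
Proof.
move=> sf l; rewrite Rpartials_slice; split=> [x|j x].
  apply: (@continuous_comp _ _ _ (fun y : 'rV[R]_d => row_mx t%:M y)).
    exact: continuous_row_mxr.
  exact: (sf _).1.
rewrite /derivable slice_quotient; exact: (sf _).2.
Qed.

Lemma partials_slice Phi t l x :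
  partials l (slice Phi t) x = partials (map (@rshift 1 d) l) Phi (row_mx t%:M x).
Proof.
rewrite /partials; congr (_ +i* _).
  by rewrite (Rpartials_slice (fun z => complex.Re (Phi z))).
by rewrite (Rpartials_slice (fun z => complex.Im (Phi z))).
Qed.

Lemma test_slice Phi t : smooth Phi -> (forall s, Defs.periodic (slice Phi s)) ->
  test (slice Phi t).
Proof.
move=> [s1 s2] p; split=> //; split.
  exact: (@Rsmooth_slice (fun z => complex.Re (Phi z))).
exact: (@Rsmooth_slice (fun z => complex.Im (Phi z))).
Qed.

Lemma slice_bounded Phi (a b : R) : smooth Phi ->
  (forall s, Defs.periodic (slice Phi s)) ->
  exists B, forall t x, a <= t <= b -> normc (slice Phi t x) <= B.
Proof.
move=> [s1 s2] p.
pose lo (i : 'I_(1 + d)) : R := if fintype.split i is inl _ then a else 0.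
pose hi (i : 'I_(1 + d)) : R := if fintype.split i is inl _ then b else 1.
have [B1 h1] := continuous_box_bounded lo hi (Rsmooth_continuous s1).
have [B2 h2] := continuous_box_bounded lo hi (Rsmooth_continuous s2).
exists (B1 + B2) => t x tab; have [k hk] := reduce_to_cube x.
rewrite -(p t k); apply: le_trans (normc_le_ReIm _) _.
have inbox i : lo i <= (row_mx t%:M (x + ivec k)) 0 i <= hi i.
  rewrite /lo /hi; case: (split_ordP i) => j ->.
    by rewrite row_mxEl mxE ord1 eqxx mulr1n.
  by rewrite row_mxEr.
by apply: lerD; [exact: h1|exact: h2].
Qed.

Lemma smooth_partial_st Phi i : smooth Phi -> smooth (partial i Phi).
Proof. by move=> sP; apply: (smooth_partials [:: i]). Qed.

Lemma slice_partial Phi t (j : 'I_d) :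
  slice (partial (rshift 1 j) Phi) t = partial j (slice Phi t).
Proof. by apply/funext => x; rewrite /partial partials_slice. Qed.

(** Compactness of the product of [[a, b]] with the unit cube, and periodicity in
    space, give a bound that is uniform in time. *)
Lemma slice_partials_bounded k Phi (a b : R) : smooth Phi ->
  (forall s, Defs.periodic (slice Phi s)) ->
  exists2 B, 0 <= B & forall t l, a <= t <= b -> (size l <= k)%N ->
    forall x, normc (partials l (slice Phi t) x) <= B.
Proof.
elim: k Phi => [|k IH] Phi sP p.
  have [B hB] := slice_bounded a b sP p.
  exists `|B| => // t [] // tab _ x; rewrite partials_nil.
  exact: le_trans (hB t x tab) (ler_norm _).
have [B B0 hB] := IH _ sP p.
have /choice [F hF] : forall j : 'I_d, exists c : R, 0 <= c /\ forall t l,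
    a <= t <= b -> (size l <= k)%N ->
    forall x, normc (partials l (partial j (slice Phi t)) x) <= c.
  move=> j; have [|s|c c0 hc] := IH (partial (rshift 1 j) Phi).
  - exact: smooth_partial_st.
  - rewrite slice_partial.
    by have [] := test_partials [:: j] (test_slice s sP p).
  exists c; split=> // t l tab lk x; rewrite -slice_partial; exact: hc.
have F0 : 0 <= \sum_j F j by apply: sumr_ge0 => j _; apply: (hF j).1.
exists (B + \sum_j F j) => [|t l tab]; first by rewrite addr_ge0.
case/lastP: l => [_ x|l j].
  by apply: le_trans (hB t [::] tab isT x) _; rewrite lerDl.
rewrite size_rcons ltnS => lk x; rewrite -cats1 partials_cat.
apply: le_trans ((hF j).2 t l tab lk x) _.
rewrite (bigD1 j) //= addrCA lerDl addr_ge0 //.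
by apply: sumr_ge0 => i _; apply: (hF i).1.
Qed.

Lemma slice_supp_partials Phi (a b : R) t l x : time_supp a b Phi ->
  ~~ (a <= t <= b) -> partials l (slice Phi t) x = 0.
Proof.
move=> supp tab; rewrite (_ : slice Phi t = fun=> 0) ?partials0 //.
by apply/funext => y; apply/eqP; apply: contraNT tab => /supp.
Qed.

End Slices.

(** * Integration in time *)

Section HalfLine.
Context {R : realType}.
Local Notation C := R[i].
Local Notation mu := (@lebesgue_measure R).
Local Notation D := (time_interval (+oo%E : \bar R)).

Lemma time_intervalE : D = `]0, +oo[%classic.
Proof.
apply/seteqP; split=> t; rewrite /time_interval /= in_itv /= andbT.
  by case.
by move=> t0; split=> //; exact: ltry.
Qed.

Lemma measurable_time_interval : measurable D.
Proof. by rewrite time_intervalE; exact: measurable_itv. Qed.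

Let mD := measurable_time_interval.

(** The integrand is dominated by [M] times the indicator function of [[a, b]]. *)
Lemma supported_integral (f : R -> R) (a b M : R) : measurable_fun D f ->
  0 <= M -> (forall t, 0 < t -> `|f t| <= M) ->
  (forall t, 0 < t -> ~~ (a <= t <= b) -> f t = 0) ->
  mu.-integrable D (EFin \o f) /\ `|\int[mu]_(t in D) f t| <= M * `|b - a|.
Proof.
move=> mf M0 fM f0; pose g (t : R) : R := M * \1_(`[a, b]%classic : set R) t.
have i1 : mu.-integrable D (EFin \o (\1_(`[a, b]%classic : set R) : R -> R)).
  by apply: integrableS (integrable_indic_itv a b true false) => //; exact: measurableT.
have ig : mu.-integrable D (EFin \o g).
  have h := @integrableZl _ _ R mu _ mD M _ i1; exact: h.
have fg t : D t -> `|f t| <= g t.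
  move=> [t0 _]; rewrite /g indicE; case: (boolP (a <= t <= b)) => tab.
    by rewrite mem_set ?mulr1 ?fM //= in_itv.
  by rewrite (f0 t t0 tab) normr0 mulr_ge0.
have int_f : mu.-integrable D (EFin \o f).
  apply: (@le_integrable _ _ R mu D mD (EFin \o f) (EFin \o g) _ _ ig); first exact/measurable_EFinP.
  move=> t Dt; rewrite /= lee_fin; exact: le_trans (fg t Dt) (ler_norm _).
split=> //; apply: le_trans (@le_normr_Rintegral _ _ R mu D f mD int_f) _.
have int_nf : mu.-integrable D (EFin \o (fun t => `|f t|)).
  have h := integrable_norm int_f; exact: h.
apply: le_trans (@le_Rintegral _ _ R mu D _ _ mD int_nf ig fg) _.
rewrite /g (@RintegralZl _ _ R mu D _ M mD i1) ler_wpM2l //.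
rewrite /Rintegral (@integral_indic _ _ R mu D mD) //.
have hab : (mu `[a, b] <= `|b - a|%:E)%E.
  rewrite [X in (X <= _)%E](lebesgue_measure_itv `[a, b]) /= lte_fin.
  by case: ifP => _; rewrite -?EFinB lee_fin ?ler_norm.
have hle : (mu (`[a, b] `&` D) <= `|b - a|%:E)%E.
  apply: le_trans hab; apply: le_measure; rewrite ?inE //.
  exact: measurableI.
rewrite -lee_fin fineK // ge0_fin_numE //; exact: le_lt_trans hle (ltry _).
Qed.

Definition cmeasurable (f : R -> C) : Prop :=
  measurable_fun D (fun t => complex.Re (f t)) /\
  measurable_fun D (fun t => complex.Im (f t)).

Lemma cmeasurable_cst z : cmeasurable (fun=> z).
Proof. by split; exact: measurable_cst. Qed.

Lemma cmeasurableD f g : cmeasurable f -> cmeasurable g ->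
  cmeasurable (fun t => f t + g t).
Proof.
move=> [f1 f2] [g1 g2]; split.
  by under eq_fun do rewrite cReD; exact: measurable_funD.
by under eq_fun do rewrite cImD; exact: measurable_funD.
Qed.

Lemma cmeasurableM f g : cmeasurable f -> cmeasurable g ->
  cmeasurable (fun t => f t * g t).
Proof.
move=> [f1 f2] [g1 g2]; split.
  under eq_fun do rewrite cReM.
  by apply: measurable_funB; apply: measurable_funM.
under eq_fun do rewrite cImM.
by apply: measurable_funD; apply: measurable_funM.
Qed.

Lemma cmeasurable_sum (I : Type) (r : seq I) (f : I -> R -> C) :
  (forall i, cmeasurable (f i)) -> cmeasurable (fun t => \sum_(i <- r) f i t).
Proof.
move=> mf; elim: r => [|i r IH].
  by under eq_fun do rewrite big_nil; exact: cmeasurable_cst.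
by under eq_fun do rewrite big_cons; exact: cmeasurableD.
Qed.

Lemma cmeasurable_cvg (h : nat -> R -> C) f : (forall n, cmeasurable (h n)) ->
  (forall t, 0 < t -> ccvg (h ^~ t) (f t)) -> cmeasurable f.
Proof.
move=> mh hf; split.
  apply: (measurable_fun_cvg (h := fun n t => complex.Re (h n t))) => [n|t [t0 _]].
    exact: (mh n).1.
  exact: (hf t t0).1.
apply: (measurable_fun_cvg (h := fun n t => complex.Im (h n t))) => [n|t [t0 _]].
  exact: (mh n).2.
exact: (hf t t0).2.
Qed.

Lemma cmeasurable_continuous (f : R -> C) :
  continuous (fun t => complex.Re (f t)) -> continuous (fun t => complex.Im (f t)) ->
  cmeasurable f.
Proof.
by move=> c1 c2; split; apply: measurable_funTS; exact: continuous_measurable_fun.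
Qed.

Lemma supported_cintegral (f : R -> C) (a b M : R) : cmeasurable f ->
  0 <= M -> (forall t, 0 < t -> normc (f t) <= M) ->
  (forall t, 0 < t -> ~~ (a <= t <= b) -> f t = 0) ->
  cintegrable D f /\ normc (cintegral D f) <= 2 * `|b - a| * M.
Proof.
move=> [m1 m2] M0 fM f0.
have [i1 n1] := @supported_integral _ a b M m1 M0
  (fun t t0 => le_trans (Re_le_normc _) (fM t t0))
  (fun t t0 tab => f_equal (@complex.Re R) (f0 t t0 tab)).
have [i2 n2] := @supported_integral _ a b M m2 M0
  (fun t t0 => le_trans (Im_le_normc _) (fM t t0))
  (fun t t0 tab => f_equal (@complex.Im R) (f0 t t0 tab)).
split=> //; apply: le_trans (normc_le_ReIm _) _.
apply: le_trans (lerD n1 n2) _.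
by rewrite le_eqVlt; apply/orP; left; apply/eqP; ring.
Qed.

Lemma cintegral_lin (a : C) (f g : R -> C) :
  cintegrable D f -> cintegrable D g ->
  cintegral D (fun t => a * f t + g t) = a * cintegral D f + cintegral D g.
Proof.
move=> [f1 f2] [g1 g2].
have lin (p q : R) (x y z : R -> R) : mu.-integrable D (EFin \o x) ->
    mu.-integrable D (EFin \o y) -> mu.-integrable D (EFin \o z) ->
    \int[mu]_(t in D) (p * x t + q * y t + z t) = p * \int[mu]_(t in D) x t
      + q * \int[mu]_(t in D) y t + \int[mu]_(t in D) z t.
  move=> ix iy iz.
  have ipx : mu.-integrable D (EFin \o (fun t => p * x t)).
    have h := @integrableZl _ _ R mu _ mD p _ ix; exact: h.
  have iqy : mu.-integrable D (EFin \o (fun t => q * y t)).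
    have h := @integrableZl _ _ R mu _ mD q _ iy; exact: h.
  have ixy : mu.-integrable D (EFin \o (fun t => p * x t + q * y t)).
    have h := @integrableD _ _ R mu _ mD _ _ ipx iqy; exact: h.
  by rewrite !RintegralD // !RintegralZl.
rewrite /cintegral; apply: complex_ext.
  rewrite cReD cReM /= -mulNr -lin //; congr Rintegral; apply/funext => t.
  by rewrite cReD cReM mulNr.
rewrite cImD cImM /= -lin //; congr Rintegral; apply/funext => t.
by rewrite cImD cImM.
Qed.

Lemma eq_cintegral (f g : R -> C) : (forall t, 0 < t -> f t = g t) ->
  cintegral D f = cintegral D g.
Proof.
move=> fg; rewrite /cintegral; congr (_ +i* _); apply: eq_Rintegral => t;
  by rewrite inE => -[t0 _]; rewrite fg.
Qed.

End HalfLine.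

(** * Time-dependent Fourier multipliers *)

Section MultiplierFamilies.
Context {R : realType} {d : nat}.
Hypothesis d0 : (0 < d)%N.
Local Notation C := R[i].
Local Notation functional := (('rV[R]_d -> C) -> C).
Local Notation D := (time_interval (+oo%E : \bar R)).
Implicit Types (phi psi : 'rV[R]_d -> C) (m : 'rV[int]_d).

Lemma zsum_lin (a : C) (c c' : 'rV[int]_d -> C) (K K' : R) :
  (forall m, normc (c m) <= K * weight m) ->
  (forall m, normc (c' m) <= K' * weight m) ->
  zsum (fun m => a * c m + c' m) = a * zsum c + zsum c'.
Proof.
move=> hc hc'; rewrite [LHS]zsumE; apply: ccvg_clim.
have := ccvgD (ccvgZ a (bsum_cvg hc)) (bsum_cvg hc').
apply: ccvg_near; apply: nearW => n.
by rewrite /bsum big_split /= mulr_sumr.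
Qed.

Variables (theta : R -> 'rV[int]_d -> R) (c : 'rV[int]_d -> C) (F : R -> functional).
Variables (K : R) (k : nat).
Hypothesis K0 : 0 <= K.
Hypothesis hc : forall m, normc (c m) <= K * qnorm m ^+ k.
Hypothesis theta_le1 : forall t m, 0 < t -> `|theta t m| <= 1.
Hypothesis theta_cont : forall m, continuous (theta ^~ m).
Hypothesis FE : forall t phi, 0 < t -> test phi ->
  F t phi = zsum (fun m => (theta t m)%:C * c m * fourier phi (- m)).

Let growth t m : 0 < t -> normc ((theta t m)%:C * c m) <= K * qnorm m ^+ k.
Proof.
move=> t0; rewrite normcM normcR; apply: le_trans (hc m).
by rewrite ler_piMl ?normc_ge0 // theta_le1.
Qed.

Let dominated t phi B : 0 < t -> test phi ->
  (forall l, (size l <= k + d.*2)%N -> forall x, normc (partials l phi x) <= B) ->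
  forall m, normc ((theta t m)%:C * c m * fourier phi (- m))
    <= @series_const R d K k B * weight m.
Proof. by move=> t0 tp hB; apply: series_dominated => // m; exact: growth. Qed.

Lemma multiplier_lin t (a : C) phi psi : 0 < t -> test phi -> test psi ->
  F t (fun x => a * phi x + psi x) = a * F t phi + F t psi.
Proof.
move=> t0 tp ts.
have [B _ hB] := test_partials_bounded (k + d.*2) tp.
have [B' _ hB'] := test_partials_bounded (k + d.*2) ts.
rewrite !FE //; last exact: test_lin.
rewrite -(zsum_lin a (dominated t0 tp hB) (dominated t0 ts hB')).
by apply: zsum_eq => m; rewrite fourier_lin //; ring.
Qed.

Definition multiplier_const : R := @series_const R d K k 1 * @wlim R d.

Lemma multiplier_const_ge0 : 0 <= multiplier_const.
Proof.
by rewrite /multiplier_const /series_const !mulr_ge0 ?exprn_ge0 ?wlim_ge0.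
Qed.

Lemma multiplier_le t phi B : 0 < t -> test phi ->
  (forall l, (size l <= k + d.*2)%N -> forall x, normc (partials l phi x) <= B) ->
  normc (F t phi) <= multiplier_const * B.
Proof.
move=> t0 tp hB; rewrite FE //; apply: le_trans (zsum_le (dominated t0 tp hB)) _.
by rewrite le_eqVlt; apply/orP; left; apply/eqP; rewrite /multiplier_const /series_const; ring.
Qed.

Section OneTest.
Variables (Phi : 'rV[R]_(1 + d) -> C).
Hypothesis tPhi : st_test (+oo%E : \bar R) Phi.

Lemma st_test_slice t : test (slice Phi t).
Proof. by case: tPhi => sP pP _; exact: test_slice. Qed.

(** Grid averages depend continuously on time, and they converge to the Fourier
    coefficient. *)
Lemma cmeasurable_fourier_slice m : cmeasurable (fun t => fourier (slice Phi t) m).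
Proof.
apply: (cmeasurable_cvg (h := fun n t => dft n.+1 (slice Phi t) m)) => [n|t t0].
  rewrite /dft /cavg; apply: cmeasurableM; first exact: cmeasurable_cst.
  apply: cmeasurable_sum => q; apply: cmeasurableM; last exact: cmeasurable_cst.
  have [[s1 s2] _ _] := tPhi.
  have cr := @continuous_row_mxl R d (grid_pt q).
  apply: cmeasurable_continuous => t.
    apply: (@continuous_comp _ _ _ (fun s : R => row_mx s%:M (grid_pt q))
      (fun z => complex.Re (Phi z))); first exact: cr.
    exact: (Rsmooth_continuous s1).
  apply: (@continuous_comp _ _ _ (fun s : R => row_mx s%:M (grid_pt q))
    (fun z => complex.Im (Phi z))); first exact: cr.
  exact: (Rsmooth_continuous s2).
by apply: dft_cvg; exact: st_test_slice.
Qed.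

Lemma cmeasurable_multiplier : cmeasurable (fun t => F t (slice Phi t)).
Proof.
apply: (cmeasurable_cvg (h := fun n t => bsum (fun m =>
  (theta t m)%:C * c m * fourier (slice Phi t) (- m)) n)) => [n|t t0].
  apply: cmeasurable_sum => m; apply: cmeasurableM.
    apply: cmeasurableM; last exact: cmeasurable_cst.
    apply: cmeasurable_continuous => /=; first exact: theta_cont.
    exact: cst_continuous.
  exact: cmeasurable_fourier_slice.
have [B _ hB] := test_partials_bounded (k + d.*2) (st_test_slice t).
rewrite FE //; last exact: st_test_slice.
exact: (bsum_cvg (dominated t0 (st_test_slice t) hB)).
Qed.

Lemma multiplier_integral (a b B : R) : time_supp a b Phi -> 0 <= B ->
  (forall t l x, a <= t <= b -> (size l <= k + d.*2)%N ->
     normc (partials l (slice Phi t) x) <= B) ->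
  cintegrable D (fun t => F t (slice Phi t)) /\
  normc (st_pair +oo%E F Phi) <= 2 * `|b - a| * (multiplier_const * B).
Proof.
move=> supp B0 hB.
have hB' t l x : (size l <= k + d.*2)%N -> normc (partials l (slice Phi t) x) <= B.
  move=> lk; case: (boolP (a <= t <= b)) => tab; first exact: hB.
  by rewrite (slice_supp_partials l x supp tab) normc0.
apply: supported_cintegral.
- exact: cmeasurable_multiplier.
- by rewrite mulr_ge0 // multiplier_const_ge0.
- move=> t t0; apply: multiplier_le => // [|l lk x]; first exact: st_test_slice.
  exact: hB'.
move=> t t0 tab; apply: eq0_normc; apply/le_anti; rewrite normc_ge0 andbT.
rewrite -(mulr0 multiplier_const); apply: multiplier_le => // [|l lk x].
  exact: st_test_slice.
by rewrite (slice_supp_partials l x supp tab) normc0.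
Qed.

Lemma multiplier_integrable : cintegrable D (fun t => F t (slice Phi t)).
Proof.
have [sP pP [a [b [a0 _ supp]]]] := tPhi.
have [B B0 hB] := slice_partials_bounded (k + d.*2) a b sP pP.
by have [] := multiplier_integral supp B0 (fun t l x tab lk => hB t l tab lk x).
Qed.

End OneTest.

(** The pairing with a slice is bounded by finitely many derivatives of the
    slice, uniformly in time, and it vanishes off the support of the test function. *)
Lemma multiplier_st_family : st_family +oo%E F.
Proof.
split=> [Phi tPhi|]; first exact: multiplier_integrable.
split=> [a Phi Psi tP tQ|a b a0 _].
  rewrite /st_pair -cintegral_lin; [|exact: multiplier_integrable..].
  apply: eq_cintegral => t t0.
  by rewrite -multiplier_lin //; exact: st_test_slice.
exists (2 * `|b - a| * multiplier_const), (k + d.*2)%N => Phi B tP supp hB.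
have B0 : 0 <= B by apply: le_trans (normc_ge0 _) _; rewrite -normc_leP; exact: (hB [::] isT 0).
have hB' t l x : a <= t <= b -> (size l <= k + d.*2)%N ->
    normc (partials l (slice Phi t) x) <= B.
  move=> _ lk; rewrite partials_slice -normc_leP; apply: hB.
  by rewrite size_map.
rewrite normc_leP; have [_ h] := multiplier_integral tP supp B0 hB'.
by rewrite -[leRHS]mulrA.
Qed.

End MultiplierFamilies.

(** * Steady solutions are mild solutions *)

Section SteadySolution.
Context {R : realType} {d : nat}.
Variable alpha : R.
Hypothesis d0 : (0 < d)%N.
Hypothesis alpha0 : 0 < alpha.
Local Notation C := R[i].
Local Notation functional := (('rV[R]_d -> C) -> C).
Local Notation lam := (fl_symbol alpha).
Variables (u : 'I_d -> functional) (w : 'I_d -> 'I_d -> functional).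
Hypothesis du : forall i, Defs.distribution (u i).
Hypothesis steady : forall i m,
  fcoef (leray (divergence w) i) m = - (lam m)%:C * fcoef (u i) m.

Lemma stationaryE t : 0 < t -> stationary u t = u.
Proof.
move=> t0; apply/funext => i; apply/funext => phi.
by rewrite /stationary indicE mem_set ?mul1r //= in_itv /= t0.
Qed.

Lemma duhamel_integrandE t i s phi :
  duhamel_integrand alpha (fun=> w) t i s phi
  = zsum (fun m => (expR (- (t - s) * lam m))%:C
      * (- (lam m)%:C * (fcoef (u i) m * fourier phi (- m)))).
Proof. by apply: zsum_eq => m; rewrite steady; ring. Qed.

(** By the stationary equation the integrand has coefficients
    [- lam exp (- (t - s) lam)] times those of [u], and the time integral of
    [lam exp (- (t - s) lam)] over [(0, t)] is [1 - exp (- t lam)]. *)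
Lemma duhamelE t i phi : 0 < t -> test phi ->
  cintegrable `]0, t[ (fun s => duhamel_integrand alpha (fun=> w) t i s phi) /\
  duhamel alpha (fun=> w) t i phi
  = zsum (fun m => (expR (- t * lam m) - 1)%:C * fcoef (u i) m * fourier phi (- m)).
Proof.
move=> t0 tp; have [K [k [K0 hK]]] := fcoef_growth (du i).
have [L [p [L0 hL]]] := lam_growth d0 alpha0.
have [B B0 hB] := test_partials_bounded ((p + k) + d.*2) tp.
pose h m := fcoef (u i) m * fourier phi (- m).
have q1 (m : 'rV[int]_d) : 1 <= qnorm m :> R by exact: qnorm_ge1.
have q0 (m : 'rV[int]_d) : 0 <= qnorm m :> R := le_trans ler01 (q1 m).
have gu m : normc (fcoef (u i) m) <= K * qnorm m ^+ (p + k).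
  by apply: le_trans (hK m) _; rewrite ler_wpM2l // ler_weXn2l // leq_addl.
have glu m : normc ((lam m)%:C * fcoef (u i) m) <= (L * K) * qnorm m ^+ (p + k).
  rewrite normcM normcR ger0_norm ?lam_ge0 // exprD mulrACA.
  by apply: ler_pM; rewrite ?normc_ge0 ?lam_ge0.
have s1 := series_dominated d0 K0 gu tp hB.
have s2 := series_dominated d0 (mulr_ge0 L0 K0) glu tp hB.
pose M := @series_const R d K (p + k) B + @series_const R d (L * K) (p + k) B.
have pos K' : 0 <= K' -> 0 <= @series_const R d K' (p + k) B.
  by move=> K0'; rewrite /series_const !mulr_ge0 ?exprn_ge0.
have hM m : normc (h m) <= M * weight m.
  apply: le_trans (s1 m) _; rewrite ler_wpM2r ?(ltW (weight_gt0 _)) //.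
  by rewrite lerDl pos // mulr_ge0.
have hM' m : normc ((lam m)%:C * h m) <= M * weight m.
  rewrite /h mulrA; apply: le_trans (s2 m) _.
  by rewrite ler_wpM2r ?(ltW (weight_gt0 _)) // lerDr pos.
have [i1 i2] := duhamel_series t0 (fun m => @lam_ge0 R d alpha m) hM' hM.
rewrite /duhamel; have -> : (fun s => duhamel_integrand alpha (fun=> w) t i s phi)
    = fun s => zsum (fun m => (expR (- (t - s) * lam m))%:C * (- (lam m)%:C * h m)).
  by apply/funext => s; exact: duhamel_integrandE.
by split=> //; rewrite i2; apply: zsum_eq => m; rewrite /h mulrA.
Qed.

Lemma stationary_fourier t i phi : 0 < t -> test phi ->
  stationary u t i phi = zsum (fun m => 1%:C * fcoef (u i) m * fourier phi (- m)).
Proof.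
move=> t0 tp; rewrite stationaryE // (dist_fourier d0 (du i) tp).
by apply: zsum_eq => m; rewrite mul1r.
Qed.

Lemma continuous_expR_time (l : R) : continuous (fun t : R => expR (- t * l)).
Proof.
rewrite (_ : (fun t : R => _) = fun t => expR (- (0 - t) * - l)).
  exact: continuous_expR_affine.
by apply/funext => t; rewrite sub0r opprK mulrN mulNr.
Qed.

Lemma st_family_stationary i : st_family +oo%E (fun t => stationary u t i).
Proof.
have [K [k [K0 hK]]] := fcoef_growth (du i).
apply: (@multiplier_st_family R d d0 (fun _ _ => 1) _ _ K k K0 hK).
- by move=> t m _; rewrite normr1.
- by move=> m; exact: cst_continuous.
by move=> t phi; exact: stationary_fourier.
Qed.

Lemma st_family_heat i : st_family +oo%E (fun t => heat alpha t (u i)).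
Proof.
have [K [k [K0 hK]]] := fcoef_growth (du i).
apply: (@multiplier_st_family R d d0 (fun t m => expR (- t * lam m)) _ _ K k K0 hK).
- move=> t m t0; rewrite ger0_norm ?expR_ge0 //.
  by apply: expRNM_le1; [exact: ltW|exact: lam_ge0].
- by move=> m; exact: continuous_expR_time.
by [].
Qed.

Lemma st_family_duhamel i : st_family +oo%E (fun t => duhamel alpha (fun=> w) t i).
Proof.
have [K [k [K0 hK]]] := fcoef_growth (du i).
apply: (@multiplier_st_family R d d0 (fun t m => expR (- t * lam m) - 1) _ _ K k K0 hK).
- move=> t m t0; have h1 := expRNM_le1 (ltW t0) (@lam_ge0 R d alpha m).
  have h2 := expR_ge0 (- t * lam m); rewrite ler_norml.
  by apply/andP; split; lra.
- move=> m t; apply: cvgB; first exact: continuous_expR_time.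
  exact: cvg_cst.
by move=> t phi t0 tp; have [] := duhamelE i t0 tp.
Qed.

(** Coefficientwise this is [1 = exp (- t lam) - (exp (- t lam) - 1)]. *)
Lemma stationary_duhamel t i phi : 0 < t -> test phi ->
  stationary u t i phi
  = -1 * duhamel alpha (fun=> w) t i phi + heat alpha t (u i) phi.
Proof.
move=> t0 tp; have [_ ->] := duhamelE i t0 tp.
have [K [k [K0 hK]]] := fcoef_growth (du i).
have [B B0 hB] := test_partials_bounded (k + d.*2) tp.
have dom (r : 'rV[int]_d -> R) : (forall m, `|r m| <= 1) -> forall m,
    normc ((r m)%:C * fcoef (u i) m * fourier phi (- m))
    <= @series_const R d K k B * weight m.
  move=> r1; apply: series_dominated => // m; rewrite normcM normcR.
  by apply: le_trans (hK m); rewrite ler_piMl ?normc_ge0.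
have le1 m := expRNM_le1 (ltW t0) (@lam_ge0 R d alpha m).
have ge0 (m : 'rV[int]_d) := expR_ge0 (- t * lam m).
have d1 := dom (fun m => expR (- t * lam m) - 1).
have d2 := dom (fun m => expR (- t * lam m)).
rewrite /heat /fseries -(zsum_lin (-1) (d1 _) (d2 _)).
- rewrite stationary_fourier //; apply: zsum_eq => m.
  by rewrite rmorphB rmorph1; ring.
- move=> m; have := le1 m; have := ge0 m; rewrite ler_norml => h1 h2.
  by apply/andP; split; lra.
by move=> m; rewrite ger0_norm.
Qed.

End SteadySolution.

Theorem proposition1p7 (R : realType) (d : nat) (alpha : R)
    (chi : 'rV[R]_d -> R)
    (u : 'I_d -> ('rV[R]_d -> R[i]) -> R[i]) :
  (2 <= d)%N -> 0 < alpha -> bump_function chi ->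
  singular_solution chi alpha u ->
  mild_solution chi alpha +oo%E u (stationary u).
Proof.
move=> d2 alpha0 _ [du0 div0 [s [s0 [w [para weak]]]]].
have d0 : (0 < d)%N by exact: leq_trans d2.
have du i : Defs.distribution (u i) by have [] := du0 i.
have dw i j : Defs.distribution (w i j) by have [_ h _ _] := para; have [] := h i j.
have steady := leray_coef du dw div0 weak.
split=> //.
  by move=> t i [t0 _]; rewrite stationaryE.
exists (fun=> w); split.
- by move=> t [t0 _]; exists s; rewrite stationaryE.
- by move=> t i phi [t0 _] tp; have [] := duhamelE d0 alpha0 du steady i t0 tp.
- move=> i; split.
  + exact: st_family_stationary.
  + exact: st_family_heat.
  + exact: (st_family_duhamel d0 alpha0 du steady i).
move=> i Phi tP.
have [intD _] := st_family_duhamel d0 alpha0 du steady i.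
have [intH _] := st_family_heat alpha d0 du i.
have tS t : test (slice Phi t) by exact: st_test_slice.
rewrite [RHS]addrC -mulN1r /st_pair -cintegral_lin; [|exact: intD|exact: intH].
apply: eq_cintegral => t t0; exact: (stationary_duhamel d0 alpha0 du steady).
Qed.
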